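(* A function $f:\Omega_D\to\mathbb{O}$ is an $O(3)$-slice function (i.e. the $O(3)$-slice function induced by some $O(3)$-stem function $E\to\mathbb{O}^4$) if and only if it is a slice function. More precisely, let $\Phi$ be the map sending each $O(3)$-stem function $\mathcal F=(\mathcal F_0,\mathcal F_1,\mathcal F_2,\mathcal F_3):E\to\mathbb{O}^4$ to the function $(F_1,F_2):D\to\mathbb{O}^2$ defined by $F_1(x_0,x_1):=\mathcal F_0(x_0,x_1,0,0)$ and $F_2(x_0,x_1):=\mathcal F_1(x_0,x_1,0,0)$. Then: (1) $\Phi$ takes values in the set of stem functions on $D$, it is a bijection from the set of $O(3)$-stem functions on $E$ onto the set of stem functions on $D$, and for every $O(3)$-stem function $\mathcal F$ the $O(3)$-slice function induced by $\mathcal F$ coincides with the slice function induced by $\Phi(\mathcal F)$. (2) If $F=(F_1,F_2):D\to\mathbb{O}^2$ is a stem function and $\mathcal F=(\mathcal F_0,\dots,\mathcal F_3)=\Phi^{-1}(F)$, then for every $v=(x_0,x_1,x_2,x_3)\in E$ with $r:=(x_1^2+x_2^2+x_3^2)^{1/2}>0$ one has $\mathcal F_0(v)=F_1(x_0,r)$ and $\mathcal F_h(v)=\frac{x_h}{r}F_2(x_0,r)$ for $h\in\{1,2,3\}$. In particular, $F$ is real analytic if and only if $\Phi^{-1}(F)$ is real analytic.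
   Context: Octonions: $\mathbb{O}=\mathbb{H}+\ell\mathbb{H}$ with product $(a+\ell b)(c+\ell d)=(ac-d\bar b)+\ell(\bar a d+cb)$ and conjugation $\overline{a+\ell b}=\bar a-\ell b$ ($a,b,c,d\in\mathbb{H}$); $\mathbb{O}$ is identified with $\mathbb{R}^8$ through the real basis $(1,i,j,k,\ell,\ell i,\ell j,\ell k)$, with Euclidean topology and norm $|x|$. $\mathbb{S}=\{I\in\mathbb{O}:I^2=-1\}$. Let $D\subset\mathbb{R}^2$ be a non-empty open set invariant under $(\alpha,\beta)\mapsto(\alpha,-\beta)$ and $\Omega_D=\{\alpha+\beta I:(\alpha,\beta)\in D, I\in\mathbb{S}\}$; assume $\Omega_D$ is connected. A stem function on $D$ is $F=(F_1,F_2):D\to\mathbb{O}^2$ with $F_1(\alpha,-\beta)=F_1(\alpha,\beta)$ and $F_2(\alpha,-\beta)=-F_2(\alpha,\beta)$. A function $f:\Omega_D\to\mathbb{O}$ is a slice function if there is a stem function $F$ with $f(\alpha+\beta I)=F_1(\alpha,\beta)+IF_2(\alpha,\beta)$ for all $(\alpha,\beta)\in D$, $I\in\mathbb{S}$ ($F$ is unique and is said to induce $f$). Identify $\mathbb{R}^2$ with $\mathbb{R}^2\times\{(0,0)\}\subset\mathbb{R}^4$ and let $E=\{(x_0,x_1,x_2,x_3)\in\mathbb{R}^4:(x_0,(x_1^2+x_2^2+x_3^2)^{1/2})\in D\}$, so $E\cap\mathbb{R}^2=D$. $O(3)$ is identified with the group of real orthogonal $4\times4$ matrices fixing the first canonical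 basis vector; such a matrix $A$ acts on $\mathbb{R}^4$ and on $\mathbb{O}^4$ by matrix–column multiplication, and $E$ is $O(3)$-invariant. $\mathcal N=\{(I,J)\in\mathbb{S}\times\mathbb{S}:I\perp J\}$ (orthogonality in $\mathbb{R}^8$). An $O(3)$-stem function is $\mathcal F:E\to\mathbb{O}^4$ with $\mathcal F(Av)=A\mathcal F(v)$ for all $v\in E$, $A\in O(3)$. One has $\Omega_D=\{x_0+x_1I+x_2J+x_3(IJ):(x_0,\dots,x_3)\in E,(I,J)\in\mathcal N\}$, and for an $O(3)$-stem function $\mathcal F$ the rule $f(x_0+x_1I+x_2J+x_3(IJ))=\mathcal F_0(v)+I\mathcal F_1(v)+J\mathcal F_2(v)+(IJ)\mathcal F_3(v)$ ($v=(x_0,\dots,x_3)\in E$, $(I,J)\in\mathcal N$) gives a well-defined function $f:\Omega_D\to\mathbb{O}$, the $O(3)$-slice function induced by $\mathcal F$. *)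

(* Defs.v *)
From HB Require Import structures.
From mathcomp Require Import all_boot all_order all_algebra.
From mathcomp Require Import all_classical all_reals all_analysis.
From mathcomp Require Import Rstruct Rstruct_topology.

Set Implicit Arguments. Unset Strict Implicit. Unset Printing Implicit Defensive.
Import Order.TTheory GRing.Theory Num.Theory.
Import numFieldNormedType.Exports.
Local Open Scope classical_set_scope.
Local Open Scope ring_scope.

Notation R := Rdefinitions.R.

(* ---------- Quaternions: row vectors in the real basis (1,i,j,k) ---------- *)
Definition quat := 'rV[R]_4.
Definition qc (x : quat) (n : nat) : R := x ord0 (inord n).
Definition qmk (a b c d : R) : quat := \row_(i < 4) nth 0 [:: a; b; c; d] i.
Definition qmul (x y : quat) : quat :=
  qmk (qc x 0 * qc y 0 - qc x 1 * qc y 1 - qc x 2 * qc y 2 - qc x 3 * qc y 3)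
      (qc x 0 * qc y 1 + qc x 1 * qc y 0 + qc x 2 * qc y 3 - qc x 3 * qc y 2)
      (qc x 0 * qc y 2 - qc x 1 * qc y 3 + qc x 2 * qc y 0 + qc x 3 * qc y 1)
      (qc x 0 * qc y 3 + qc x 1 * qc y 2 - qc x 2 * qc y 1 + qc x 3 * qc y 0).
Definition qconj (x : quat) : quat := qmk (qc x 0) (- qc x 1) (- qc x 2) (- qc x 3).

(* ---------- Octonions O = H + l H : the pair (a,b) stands for a + l b ------
   so that the real coordinates of (a,b) in the basis
   (1,i,j,k,l,li,lj,lk) are (a_0,..,a_3,b_0,..,b_3).  The product type carries
   the lmodType structure over R and the (Euclidean) product topology. *)
Definition oct := (quat * quat)%type.
Definition omul (x y : oct) : oct :=
  (qmul x.1 y.1 - qmul y.2 (qconj x.2), qmul (qconj x.1) y.2 + qmul y.1 x.2).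
Definition oconj (x : oct) : oct := (qconj x.1, - x.2).
Definition oone : oct := (qmk 1 0 0 0, 0).

Definition ocoord (x : oct) (n : nat) : R :=
  if leq n.+1 4 then qc x.1 n else qc x.2 (n - 4).
Definition odot (x y : oct) : R := \sum_(i < 8) ocoord x i * ocoord y i.

Definition Sph : set oct := [set I | omul I I = - oone].
Definition Nset : set (oct * oct) :=
  [set IJ | Sph IJ.1 /\ Sph IJ.2 /\ odot IJ.1 IJ.2 = 0].

Definition Omega (D : set (R * R)) : set oct :=
  [set x | exists a b I, D (a, b) /\ Sph I /\ x = a *: oone + b *: I].

Definition vec4 (a b c d : R) : 'cV[R]_4 := \col_(i < 4) nth 0 [:: a; b; c; d] i.
Definition vc (v : 'cV[R]_4) (n : nat) : R := v (inord n) ord0.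
Definition radv (v : 'cV[R]_4) : R := Num.sqrt (vc v 1 ^+ 2 + vc v 2 ^+ 2 + vc v 3 ^+ 2).
Definition Eset (D : set (R * R)) : set 'cV[R]_4 := [set v | D (vc v 0, radv v)].

Definition O3 : set 'M[R]_4 :=
  [set A | A^T *m A = 1%:M /\ A *m vec4 1 0 0 0 = vec4 1 0 0 0].

Definition stem (D : set (R * R)) (F : R * R -> oct * oct) : Prop :=
  forall a b, D (a, b) ->
    (F (a, - b)).1 = (F (a, b)).1 /\ (F (a, - b)).2 = - (F (a, b)).2.

Definition slice_induced (D : set (R * R)) (F : R * R -> oct * oct)
    (f : oct -> oct) : Prop :=
  forall a b I, D (a, b) -> Sph I ->
    f (a *: oone + b *: I) = (F (a, b)).1 + omul I (F (a, b)).2.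

Definition slice_fun (D : set (R * R)) (f : oct -> oct) : Prop :=
  exists F, stem D F /\ slice_induced D F f.

Definition oi (n : nat) : 'I_4 := inord n.

Definition act4 (A : 'M[R]_4) (w : 'I_4 -> oct) : 'I_4 -> oct :=
  fun i => \sum_(j < 4) A i j *: w j.

Definition O3stem (D : set (R * R)) (F : 'cV[R]_4 -> 'I_4 -> oct) : Prop :=
  forall v A, Eset D v -> O3 A -> F (A *m v) = act4 A (F v).

Definition o3pt (v : 'cV[R]_4) (I J : oct) : oct :=
  vc v 0 *: oone + vc v 1 *: I + vc v 2 *: J + vc v 3 *: omul I J.

Definition o3val (F : 'cV[R]_4 -> 'I_4 -> oct) (v : 'cV[R]_4) (I J : oct) : oct :=
  F v (oi 0) + omul I (F v (oi 1)) + omul J (F v (oi 2)) + omul (omul I J) (F v (oi 3)).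

Definition o3slice_induced (D : set (R * R)) (F : 'cV[R]_4 -> 'I_4 -> oct)
    (f : oct -> oct) : Prop :=
  forall v I J, Eset D v -> Nset (I, J) -> f (o3pt v I J) = o3val F v I J.

Definition o3slice_fun (D : set (R * R)) (f : oct -> oct) : Prop :=
  exists F, O3stem D F /\ o3slice_induced D F f.

Definition Phi (F : 'cV[R]_4 -> 'I_4 -> oct) : R * R -> oct * oct :=
  fun p => (F (vec4 p.1 p.2 0 0) (oi 0), F (vec4 p.1 p.2 0 0) (oi 1)).

(* g : R^n -> R is real analytic on U: around every point p of U it is the sum
   of an absolutely convergent power series sum_alpha c_alpha (x-p)^alpha
   (alpha ranging over multi-indices 'I_n -> nat; absolute convergence makes
   the sum independent of the order, so we use the box partial sums over
   alpha with all alpha_i < k). *)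
Definition psum (n : nat) (c : ('I_n -> nat) -> R) (y : 'cV[R]_n) (k : nat) : R :=
  \sum_(al : {ffun 'I_n -> 'I_k}) c (fun i => nat_of_ord (al i)) *
     \prod_(i < n) y i ord0 ^+ al i.
Definition pabssum (n : nat) (c : ('I_n -> nat) -> R) (y : 'cV[R]_n) (k : nat) : R :=
  \sum_(al : {ffun 'I_n -> 'I_k}) `|c (fun i => nat_of_ord (al i))| *
     \prod_(i < n) `|y i ord0| ^+ al i.

Definition real_analytic_on (n : nat) (U : set 'cV[R]_n) (g : 'cV[R]_n -> R) : Prop :=
  forall p, U p -> exists2 r : R, 0 < r &
    exists c : ('I_n -> nat) -> R, forall x, `|x - p| < r ->
      (exists M : R, forall k, pabssum c (x - p) k <= M) /\
      (psum c (x - p) @ \oo --> g x).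

Definition vec2 (a b : R) : 'cV[R]_2 := \col_(i < 2) nth 0 [:: a; b] i.
Definition vc2 (y : 'cV[R]_2) (n : nat) : R := y (inord n) ord0.

Definition stem_real_analytic (D : set (R * R)) (F : R * R -> oct * oct) : Prop :=
  forall (k : bool) (m : 'I_8),
    real_analytic_on [set y | D (vc2 y 0, vc2 y 1)]
      (fun y => ocoord (if k then (F (vc2 y 0, vc2 y 1)).1
                             else (F (vc2 y 0, vc2 y 1)).2) m).

Definition o3_real_analytic (D : set (R * R)) (F : 'cV[R]_4 -> 'I_4 -> oct) : Prop :=
  forall (h : 'I_4) (m : 'I_8), real_analytic_on (Eset D) (fun v => ocoord (F v h) m).

(* Main.v *)
(** An O(3)-stem function is determined by its restriction to the half-plane
    [x2 = x3 = 0], [x1 >= 0]: every point is moved there by a Householder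
    reflection in O(3), and sign changes of the coordinates kill its last two
    components there.  This gives the explicit formula for the inverse of [Phi].

    For analyticity we use functions on a cube whose Taylor series has a finite
    weighted l^1 norm; these are stable under products and under normally
    convergent series, hence under composition.  Away from the real axis the
    radius is analytic, as [sqrt (1 + z) - 1] is the limit of a contraction.
    On the axis the parity of [F] leaves only monomials that become polynomials
    in the coordinates once the square of the radius is substituted. *)

Require Import Defs.
From HB Require Import structures.
From mathcomp Require Import all_boot all_order all_algebra.
From mathcomp Require Import all_classical all_reals all_analysis.
From mathcomp Require Import Rstruct Rstruct_topology.
From mathcomp Require Import ring lra.
Set Implicit Arguments. Unset Strict Implicit. Unset Printing Implicit Defensive.
Import Order.TTheory GRing.Theory Num.Theory.
Import numFieldNormedType.Exports.
Local Open Scope classical_set_scope.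
Local Open Scope ring_scope.

(** * Power series with finite weighted l^1 norm *)

Lemma cvgn_eq (K : realType) (u v : nat -> K) (l : K) :
  (forall k, u k = v k) -> u @ \oo --> l -> v @ \oo --> l.
Proof. by move=> /funext ->. Qed.

Lemma cvgn_lincomb (K : realType) (u v w : nat -> K) (a b l l' l'' : K) :
  u @ \oo --> l -> v @ \oo --> l' -> (forall k, w k = a * u k + b * v k) ->
  l'' = a * l + b * l' -> w @ \oo --> l''.
Proof.
move=> ul vl e ->; have -> : w = (fun k => a * u k) + (fun k => b * v k) by apply/funext.
by apply: cvgD; exact: cvgMl_tmp.
Qed.

Lemma cvgn_sum (K : realType) (I : Type) (s : seq I) (P : pred I) (u : I -> nat -> K) (l : I -> K) :
  (forall i, P i -> u i J @[J --> \oo] --> l i) ->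
  \sum_(i <- s | P i) u i J @[J --> \oo] --> \sum_(i <- s | P i) l i.
Proof.
move=> H; elim: s => [|i s IH].
  rewrite big_nil; apply: cvg_near_cst; apply: nearW => J; exact: big_nil.
have -> : (fun J => \sum_(j <- i :: s | P j) u j J) =
  (fun J => if P i then u i J + \sum_(j <- s | P j) u j J else \sum_(j <- s | P j) u j J).
  by apply/funext => J; rewrite big_cons.
rewrite big_cons; case Pi : (P i) => //.
exact: (cvgD (H _ Pi) IH).
Qed.

(** * Sums over boxes of multi-indices, monomials and weights *)

Section BoxSums.
Variables (K : realType) (n : nat).
Implicit Types (k m : nat) (G : ('I_n -> nat) -> K) (c : ('I_n -> nat) -> K).

(** The summand lives on plain functions to nat, so that boxes of different sizes share it; [psum]
    is an instance by unfolding. *)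
Definition boxsum k G : K := \sum_(al : {ffun 'I_n -> 'I_k}) G (fun i => al i).

Lemma boxsum_widen k m G : (k <= m)%N ->
  boxsum k G = \sum_(al : {ffun 'I_n -> 'I_m} | [forall i, (al i < k)%N]) G (fun i => al i).
Proof.
move=> km.
pose h (al : {ffun 'I_n -> 'I_k}) : {ffun 'I_n -> 'I_m} := [ffun i => widen_ord km (al i)].
have hinj : injective h.
  move=> a b /ffunP ab; apply/ffunP => i; apply/val_inj.
  by have := ab i; rewrite !ffunE => /(congr1 val).
transitivity (\sum_(be in [set h al | al in [set: {ffun 'I_n -> 'I_k}]]%SET)
    G (fun i => be i)).
  rewrite big_imset /=; last by move=> a b _ _; exact: hinj.
  rewrite /boxsum; apply: eq_big => [a|a _]; first by rewrite inE.
  by congr G; apply/funext => i; rewrite ffunE.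
apply: eq_bigl => be; apply/imsetP/forallP => [[al _ ->] i|H].
  by rewrite ffunE /=.
exists [ffun i => Ordinal (H i)]; first by rewrite inE.
by apply/ffunP => i; rewrite !ffunE; apply/val_inj.
Qed.

(** Writing the difference of two boxes as a finite sum lets finite-sum bounds apply to it. *)
Lemma boxsum_shell k m G : (k <= m)%N ->
  boxsum m G - boxsum k G =
  \sum_(al : {ffun 'I_n -> 'I_m} | ~~ [forall i, (al i < k)%N]) G (fun i => al i).
Proof.
move=> km; rewrite (@boxsum_widen k m) // /boxsum.
by rewrite (bigID (fun al : {ffun 'I_n -> 'I_m} => [forall i, (al i < k)%N])) /= addrAC subrr add0r.
Qed.

Lemma eq_boxsum k G G' : G =1 G' -> boxsum k G = boxsum k G'.
Proof. by move=> e; apply: eq_bigr => al _; rewrite e. Qed.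

Lemma boxsum_le k G G' : (forall a, G a <= G' a) -> boxsum k G <= boxsum k G'.
Proof. by move=> e; apply: ler_sum => al _; exact: e. Qed.

Lemma boxsum_ge0 k G : (forall a, 0 <= G a) -> 0 <= boxsum k G.
Proof. by move=> e; apply: sumr_ge0. Qed.

Lemma ler_norm_boxsum k G : `|boxsum k G| <= boxsum k (fun a => `|G a|).
Proof. exact: ler_norm_sum. Qed.

Lemma boxsumD k G G' : boxsum k (fun a => G a + G' a) = boxsum k G + boxsum k G'.
Proof. exact: big_split. Qed.

Lemma boxsumZ k x G : boxsum k (fun a => x * G a) = x * boxsum k G.
Proof. by rewrite /boxsum mulr_sumr. Qed.

Lemma boxsumN k G : boxsum k (fun a => - G a) = - boxsum k G.
Proof. by rewrite /boxsum sumrN. Qed.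

Lemma boxsum_sum (I : Type) (s : seq I) (P : pred I) k (G : I -> ('I_n -> nat) -> K) :
  boxsum k (fun a => \sum_(i <- s | P i) G i a) = \sum_(i <- s | P i) boxsum k (G i).
Proof. exact: exchange_big. Qed.

Lemma boxsum_cvg (u : nat -> ('I_n -> nat) -> K) G k :
  (forall a, u J a @[J --> \oo] --> G a) -> boxsum k (u J) @[J --> \oo] --> boxsum k G.
Proof. by move=> H; apply: cvgn_sum => al _; exact: H. Qed.

(** A box of side one more than the largest exponent contains [a]. Applied to weighted coefficients,
    this bounds a single coefficient by the norm of the whole series. *)
Lemma boxsum_term (a : 'I_n -> nat) G : (forall b, 0 <= G b) ->
  G a <= boxsum (\max_i a i).+1 G.
Proof.
move=> G0; pose al : {ffun 'I_n -> 'I_(\max_i a i).+1} := [ffun i => inord (a i)].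
rewrite /boxsum (bigD1 al) //=.
have -> : (fun i => al i : nat) = a.
  by apply/funext => i; rewrite ffunE inordK // ltnS; apply: leq_bigmax.
by rewrite lerDl; apply: sumr_ge0.
Qed.

Definition mon (y : 'cV[K]_n) (a : 'I_n -> nat) : K := \prod_(i < n) y i ord0 ^+ a i.
Definition wt (rho : K) (a : 'I_n -> nat) : K := \prod_(i < n) rho ^+ a i.


Lemma wt_ge0 rho a : 0 <= rho -> 0 <= wt rho a.
Proof. by move=> r0; apply: prodr_ge0 => i _; apply: exprn_ge0. Qed.

Lemma wt_gt0 rho a : 0 < rho -> 0 < wt rho a.
Proof. by move=> r0; apply: prodr_gt0 => i _; apply: exprn_gt0. Qed.

Definition incube (rho : K) (y : 'cV[K]_n) := forall i, `|y i ord0| <= rho.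

Lemma mon_le_wt rho y a : incube rho y -> `|mon y a| <= wt rho a.
Proof.
move=> H; rewrite /mon normr_prod; apply: ler_prod => i _.
by rewrite normr_ge0 normrX lerXn2r // nnegrE (le_trans _ (H i)).
Qed.

Lemma monD y a b : mon y (fun i => a i + b i)%N = mon y a * mon y b.
Proof. by rewrite /mon -big_split; apply: eq_bigr => i _; rewrite exprD. Qed.

Lemma wtD r a b : wt r (fun i => a i + b i)%N = wt r a * wt r b.
Proof. by rewrite /wt -big_split; apply: eq_bigr => i _; rewrite exprD. Qed.

(* The weighted l^1 norm of the Taylor series of [g] at 0 on the cube of radius
   [rho] is at most [M], and that series sums to [g] there. *)
Definition PS (rho M : K) (g : 'cV[K]_n -> K) := exists c : ('I_n -> nat) -> K,
  (forall k, boxsum k (fun a => `|c a| * wt rho a) <= M) /\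
  (forall y, incube rho y -> boxsum k (fun a => c a * mon y a) @[k --> \oo] --> g y).

End BoxSums.

(** * Sums and normally convergent series *)

Section Closure.
Variables (K : realType) (n : nat) (rho : K).
Hypothesis rho0 : 0 < rho.
Implicit Types (g h : 'cV[K]_n -> K) (M N : K).

Lemma PS_ge0 M g : PS rho M g -> 0 <= M.
Proof.
case=> c [H _]; apply: le_trans (H 0); apply: boxsum_ge0 => a.
by rewrite mulr_ge0 // wt_ge0 // ltW.
Qed.

Lemma PS_bound M g y : PS rho M g -> incube rho y -> `|g y| <= M.
Proof.
case=> c [H1 H2] yr; have /cvg_norm H3 := H2 _ yr.
apply: (cvgr_to_le H3); apply: nearW => k.
apply: le_trans (H1 k); apply: le_trans (ler_norm_boxsum _ _) _.
apply: boxsum_le => a; rewrite normrM ler_wpM2l //; exact: mon_le_wt.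
Qed.

Lemma PS_eq M g h : (forall y, incube rho y -> g y = h y) -> PS rho M g -> PS rho M h.
Proof. by move=> e [c [H1 H2]]; exists c; split=> // y yr; rewrite -e //; exact: H2. Qed.

Lemma PS_le M N g : M <= N -> PS rho M g -> PS rho N g.
Proof. by move=> e [c [H1 H2]]; exists c; split=> // k; exact: le_trans e. Qed.

Lemma PSD M N g h : PS rho M g -> PS rho N h -> PS rho (M + N) (fun y => g y + h y).
Proof.
move=> [c [H1 H2]] [d [H3 H4]]; exists (fun a => c a + d a); split=> [k|y yr].
  apply: le_trans (lerD (H1 k) (H3 k)); rewrite -boxsumD; apply: boxsum_le => a.
  by rewrite -mulrDl ler_wpM2r ?ler_normD // wt_ge0 // ltW.
apply: cvgn_eq (cvgD (H2 _ yr) (H4 _ yr)) => k.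
by rewrite -[LHS]/(boxsum k _ + boxsum k _) -boxsumD; apply: eq_boxsum => a; rewrite mulrDl.
Qed.

Lemma PSZ x M g : PS rho M g -> PS rho (`|x| * M) (fun y => x * g y).
Proof.
move=> [c [H1 H2]]; exists (fun a => x * c a); split=> [k|y yr].
  apply: le_trans (ler_wpM2l (normr_ge0 x) (H1 k)); rewrite -boxsumZ.
  by apply: boxsum_le => a; rewrite normrM mulrA.
apply: cvgn_eq (cvgMl_tmp (a := x) (H2 _ yr)) => k.
by rewrite -[LHS]/(x * boxsum k _) -boxsumZ; apply: eq_boxsum => a; rewrite mulrA.
Qed.

Lemma PS0 : @PS K n rho 0 (fun=> 0).
Proof.
exists (fun=> 0); split=> [k|y yr].
  by rewrite /boxsum big1 // => al _; rewrite normr0 mul0r.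
by apply: cvg_near_cst; apply: nearW => k; rewrite /boxsum big1 // => al _; rewrite mul0r.
Qed.

Lemma PS_sum (I : Type) (s : seq I) (P : pred I) (N : I -> K) (g : I -> 'cV[K]_n -> K) :
  (forall i, P i -> PS rho (N i) (g i)) ->
  PS rho (\sum_(i <- s | P i) N i) (fun y => \sum_(i <- s | P i) g i y).
Proof.
move=> H; elim: s => [|i s IH].
  by rewrite big_nil; apply: PS_eq PS0 => y _; rewrite big_nil.
rewrite big_cons; case Pi : (P i).
  by apply: PS_eq (PSD (H _ Pi) IH) => y _; rewrite big_cons Pi.
by apply: PS_eq IH => y _; rewrite big_cons Pi.
Qed.

(** This is completeness of the weighted l^1 space: the coefficients of the partial sums converge
    one by one, and the tail of the bounds [N j] controls the distance to their limit in norm, hence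
    also uniformly on the cube. *)
Lemma PS_series (g : nat -> 'cV[K]_n -> K) (N : nat -> K) M h :
  (forall j, PS rho (N j) (g j)) ->
  (forall J, \sum_(0 <= j < J) N j <= M) ->
  (forall y, incube rho y -> \sum_(0 <= j < J) g j y @[J --> \oo] --> h y) ->
  PS rho M h.
Proof.
move=> gN HM Hh; have N0 j : 0 <= N j by exact: PS_ge0 (gN j).
have [c Hc] := choice gN.
have w0 (a : 'I_n -> nat) : 0 < wt rho a by exact: wt_gt0.
pose S J := \sum_(0 <= j < J) N j.
have SB J J' : (J <= J')%N -> S J' - S J = \sum_(J <= j < J') N j.
  by move=> JJ; rewrite /S (@big_cat_nat _ _ _ J) //= addrAC subrr add0r.
have Smono : {homo S : a b / (a <= b)%N >-> a <= b}.
  by move=> a b ab; rewrite -subr_ge0 SB // sumr_ge0.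
have Scvg : cvgn S.
  by apply: nondecreasing_is_cvgn => //; exists M => _ [J _ <-]; exact: HM.
pose L : K := limn S.
have SL J : S J <= L by exact: nondecreasing_cvgn_le.
have LM : L <= M by apply: limr_le => //; apply: nearW.
pose C J a := \sum_(0 <= j < J) c j a.
(* A single coefficient of the j-th series is at most [N j] divided by its weight, so comparison
   with the sum of the [N j] applies. *)
have cc a : cvgn (series (fun j => c j a)).
  apply: normed_cvg; apply: (@series_le_cvg _ _ (fun j => N j * (wt rho a)^-1)) => [j|j|j|] //=.
  - by rewrite mulr_ge0 // invr_ge0 ltW.
  - rewrite ler_pdivlMr //; apply: le_trans ((Hc j).1 (\max_i a i).+1).
    apply: (@boxsum_term K n a (fun a => `|c j a| * wt rho a)) => b.
    by rewrite mulr_ge0 // ltW.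
  - have -> : series (fun j => N j * (wt rho a)^-1) = (fun J => S J * (wt rho a)^-1).
      by apply/funext => J; rewrite /series /= /S mulr_suml.
    exact: is_cvgMr_tmp Scvg.
pose c' a : K := limn (C^~ a).
have Ccvg a : C J a @[J --> \oo] --> c' a by exact: cc.
have CC J J' k : (J <= J')%N ->
    boxsum k (fun a => `|C J' a - C J a| * wt rho a) <= S J' - S J.
  move=> JJ; rewrite SB //.
  apply: (@le_trans _ _ (boxsum k (fun a => \sum_(J <= j < J') `|c j a| * wt rho a))).
    apply: boxsum_le => a; rewrite /C (@big_cat_nat _ _ _ J 0 J') //= addrAC subrr add0r.
    rewrite -mulr_suml; apply: ler_wpM2r; [exact: ltW|exact: ler_norm_sum].
  by rewrite boxsum_sum; apply: ler_sum => j _; exact: (Hc j).1.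
(* A box sum is finite, so the limit in [J'] can be taken inside it. *)
have CL J k : boxsum k (fun a => `|c' a - C J a| * wt rho a) <= L - S J.
  have E : boxsum k (fun a => `|C J' a - C J a| * wt rho a) @[J' --> \oo] -->
      boxsum k (fun a => `|c' a - C J a| * wt rho a).
    apply: boxsum_cvg => a; apply: cvgMr_tmp; apply: cvg_norm.
    by apply: cvgB; [exact: Ccvg|exact: cvg_cst].
  apply: (cvgr_to_le E); near=> J'.
  apply: le_trans (CC J J' k _) _; last by rewrite lerD2r.
  by near: J'; exact: nbhs_infty_ge.
exists c'; split=> [k|y yr].
  apply: le_trans LM; have := CL 0 k; rewrite /S big_nil subr0; apply: le_trans.
  by apply: boxsum_le => a; rewrite /C big_nil subr0.
have gL J : `|h y - \sum_(0 <= j < J) g j y| <= L - S J.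
  have E : `|\sum_(0 <= j < J') g j y - \sum_(0 <= j < J) g j y| @[J' --> \oo] -->
     `|h y - \sum_(0 <= j < J) g j y|.
    by apply: cvg_norm; apply: cvgB; [exact: Hh|exact: cvg_cst].
  apply: (cvgr_to_le E); near=> J'.
  have JJ : (J <= J')%N by near: J'; exact: nbhs_infty_ge.
  rewrite (@big_cat_nat _ _ _ J 0 J') //= addrAC subrr add0r.
  apply: (@le_trans _ _ (S J' - S J)); last by rewrite lerD2r.
  rewrite SB //; apply: le_trans (ler_norm_sum _ _ _) _.
  by apply: ler_sum => j _; exact: PS_bound.
(* Three-epsilon argument through the J-th partial sum of functions and its box sums; the bound
   between the box sums of [C J] and of [c'] is uniform in the size of the box. *)
apply/cvgrPdist_le => e e0.
have [J LJ] : exists J, L - S J <= e / 3.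
  have /cvgrPdist_le /(_ (e / 3)) := Scvg.
  rewrite divr_gt0 // => /(_ isT) [J _ /(_ J (leqnn _))] /= HJ.
  by exists J; apply: le_trans HJ; exact: ler_norm.
have B : boxsum k (fun a => C J a * mon y a) @[k --> \oo] --> \sum_(0 <= j < J) g j y.
  have E : \sum_(0 <= j < J) boxsum k (fun a => c j a * mon y a) @[k --> \oo] -->
     \sum_(0 <= j < J) g j y by apply: cvgn_sum => j _; exact: (Hc j).2.
  apply: cvgn_eq E => k.
  by rewrite -boxsum_sum; apply: eq_boxsum => a; rewrite /C mulr_suml.
move/cvgrPdist_le : B => /(_ (e / 3)); rewrite divr_gt0 // => /(_ isT) B.
near=> k.
have B' : `|\sum_(0 <= j < J) g j y - boxsum k (fun a => C J a * mon y a)| <= e / 3.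
  by near: k.
have D' : `|boxsum k (fun a => C J a * mon y a) - boxsum k (fun a => c' a * mon y a)| <= e / 3.
  apply: le_trans LJ; apply: le_trans (CL J k).
  rewrite distrC -boxsumN -boxsumD; apply: le_trans (ler_norm_boxsum _ _) _.
  apply: boxsum_le => a; rewrite -mulrBl normrM ler_wpM2l //; exact: mon_le_wt.
have A' := le_trans (gL J) LJ.
have -> : e = e / 3 + e / 3 + e / 3 by field.
set s := \sum_(_ <= _ < _) _ in A' B'; set u := boxsum _ _ in B' D'; set v := boxsum _ _ in D' *.
have -> : h y - v = (h y - s) + (s - u) + (u - v) by ring.
apply: le_trans (ler_normD _ _) _; rewrite lerD //.
by apply: le_trans (ler_normD _ _) _; rewrite lerD.
Unshelve. all: by end_near. Qed.

End Closure.

(** With at least one variable the box of side 0 is empty; with none it would contain the empty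
    multi-index. Telescoping over boxes starts from this value, whence the dimensions of the form
    [m.+1]. *)
Lemma boxsum0 (K : realType) (m : nat) (G : ('I_m.+1 -> nat) -> K) : boxsum 0 G = 0.
Proof. by rewrite /boxsum big1 // => al _; case: (al ord0). Qed.

(** The Kronecker delta is tested pointwise to remain a boolean on plain functions. It supplies the
    coefficients of a monomial and isolates the constant term of a series. *)
Lemma boxsum_delta (K : realType) (n k : nat) (a : 'I_n -> nat) (G : ('I_n -> nat) -> K) :
  boxsum k (fun b => [forall i, b i == a i]%:R * G b) =
  if [forall i, (a i < k)%N] then G a else 0.
Proof.
rewrite /boxsum; case: ifPn => [/forallP ak|/forallPn[i ik]]; last first.
  rewrite big1 // => al _; case: forallP => [/(_ i)/eqP e|_]; last by rewrite mul0r.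
  by rewrite -e ltn_ord in ik.
pose al : {ffun 'I_n -> 'I_k} := [ffun i => Ordinal (ak i)].
have ala : (fun i => al i : nat) = a by apply/funext => i; rewrite ffunE.
rewrite (bigD1 al) //= ala big1 ?addr0 => [|be /eqP ne].
  by case: forallP => [_|nH]; [rewrite mul1r|case: nH => i; rewrite ffunE].
case: forallP => [e|_]; last by rewrite mul0r.
by case: ne; apply/ffunP => i; apply/val_inj; rewrite /= (eqP (e i)) -ala.
Qed.

(** * Multiple series of functions, and the basic examples *)

Section Algebra.
Variables (K : realType) (n : nat) (rho : K).
Hypothesis rho0 : 0 < rho.

(* The telescoping shells between consecutive boxes turn a multiple series into
   a simple one. *)
Lemma PS_boxseries (m : nat) (d : ('I_m.+1 -> nat) -> K)
    (G : ('I_m.+1 -> nat) -> 'cV[K]_n -> K) (N : ('I_m.+1 -> nat) -> K) M h :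
  (forall b, PS rho (N b) (G b)) ->
  (forall k, boxsum k (fun b => `|d b| * N b) <= M) ->
  (forall y, incube rho y -> boxsum k (fun b => d b * G b y) @[k --> \oo] --> h y) ->
  PS rho M h.
Proof.
move=> GN HM Hh.
pose g j y := boxsum j.+1 (fun b => d b * G b y) - boxsum j (fun b => d b * G b y).
pose N' j := boxsum j.+1 (fun b => `|d b| * N b) - boxsum j (fun b => `|d b| * N b).
apply: (@PS_series _ _ _ rho0 g N') => [j|J|y yr].
- rewrite /N' boxsum_shell //.
  pose s j (al : {ffun 'I_m.+1 -> 'I_j.+1}) y :=
    d (fun i => al i) * G (fun i => al i) y.
  apply: (@PS_eq _ _ _ _
    (fun y => \sum_(al : {ffun 'I_m.+1 -> 'I_j.+1} | ~~ [forall i, (al i < j)%N]) s j al y)).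
    by move=> y _; rewrite /g boxsum_shell.
  by apply: PS_sum => // al _; exact: PSZ.
- by rewrite telescope_sumr // boxsum0 subr0.
- apply: cvgn_eq (Hh _ yr) => k.
  by rewrite (telescope_sumr (fun j => boxsum j (fun b => d b * G b y))) // boxsum0 subr0.
Qed.

Lemma PS_mon (a : 'I_n -> nat) : PS rho (wt rho a) (fun y => mon y a).
Proof.
exists (fun b => [forall i, b i == a i]%:R); split=> [k|y yr].
  under eq_boxsum do rewrite normr_nat.
  by rewrite boxsum_delta; case: ifP => // _; rewrite wt_ge0 // ltW.
apply: cvg_near_cst; near=> k; rewrite boxsum_delta ifT //.
apply/forallP => i; apply: (@leq_ltn_trans (\max_i a i)); first exact: leq_bigmax.
by near: k; exact: nbhs_infty_gt.
Unshelve. all: by end_near. Qed.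

Lemma PS_cst x : @PS K n rho `|x| (fun=> x).
Proof.
have := PSZ x (PS_mon (fun=> 0)).
have -> : wt rho (fun _ : 'I_n => 0) = 1 by rewrite /wt big1.
rewrite mulr1; apply: PS_eq => y _.
by rewrite /mon big1 ?mulr1.
Qed.

Lemma PS_coord (i : 'I_n) : PS rho rho (fun y => y i ord0).
Proof.
have := PS_mon (fun j => (j == i) : nat).
have -> : wt rho (fun j => (j == i) : nat) = rho.
  by rewrite /wt (bigD1 i) //= eqxx expr1 big1 ?mulr1 // => j /negbTE ->.
apply: PS_eq => y _.
by rewrite /mon (bigD1 i) //= eqxx expr1 big1 ?mulr1 // => j /negbTE ->.
Qed.

Lemma PSB M N g h : PS rho M g -> PS rho N h -> @PS K n rho (M + N) (fun y => g y - h y).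
Proof.
move=> gM /(PSZ (-1)); rewrite normrN1 mul1r => hN.
by apply: PS_eq (PSD rho0 gM hN) => y _; rewrite mulN1r.
Qed.

End Algebra.

(** * Products, composition and shrinking of the cube *)

Section Products.
Variables (K : realType) (n : nat) (rho : K).
Hypothesis rho0 : 0 < rho.
Implicit Types (g h : 'cV[K]_n.+1 -> K) (M N : K).

(** Multiplying by a monomial shifts all exponents, and weights are multiplicative under the
    shift. *)
Lemma PS_monM (b : 'I_n.+1 -> nat) M g :
  PS rho M g -> PS rho (wt rho b * M) (fun y => mon y b * g y).
Proof.
case=> c [H1 H2].
apply: (@PS_boxseries _ _ _ rho0 _ c (fun a y => mon y (fun i => a i + b i)%N)
  (fun a => wt rho (fun i => a i + b i)%N)) => [a|k|y yr].
- exact: PS_mon.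
- under eq_boxsum do rewrite wtD mulrA mulrC.
  by rewrite boxsumZ; apply: ler_wpM2l => //; rewrite wt_ge0 // ltW.
- apply: cvgn_eq (cvgMl_tmp (a := mon y b) (H2 _ yr)) => k.
  by rewrite -boxsumZ; apply: eq_boxsum => a; rewrite monD; ring.
Qed.

(** Expanding [g] leaves a series of monomials times [h], each covered by the monomial case; no
    Cauchy product of coefficients has to be formed. *)
Lemma PSM M N g h : PS rho M g -> PS rho N h -> PS rho (M * N) (fun y => g y * h y).
Proof.
move=> [c [H1 H2]] hN.
apply: (@PS_boxseries _ _ _ rho0 _ c (fun a y => mon y a * h y)
  (fun a => wt rho a * N)) => [a|k|y yr].
- exact: PS_monM.
- under eq_boxsum do rewrite mulrA mulrC.
  by rewrite boxsumZ mulrC; apply: ler_wpM2r => //; exact: PS_ge0 hN.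
- apply: cvgn_eq (cvgMr_tmp (b := h y) (H2 _ yr)) => k.
  by rewrite mulrC -boxsumZ; apply: eq_boxsum => a; ring.
Qed.

Lemma PSX j M g : PS rho M g -> PS rho (M ^+ j) (fun y => g y ^+ j).
Proof.
move=> gM; elim: j => [|j IH].
  have := PS_cst n.+1 rho0 1; rewrite normr1 expr0.
  by apply: PS_eq => y _; rewrite expr0.
by rewrite exprS; apply: PS_eq (PSM gM IH) => y _; rewrite exprS.
Qed.

Lemma PS_prod (I : Type) (s : seq I) (P : pred I) (N : I -> K) (g : I -> 'cV[K]_n.+1 -> K) :
  (forall i, P i -> PS rho (N i) (g i)) ->
  PS rho (\prod_(i <- s | P i) N i) (fun y => \prod_(i <- s | P i) g i y).
Proof.
move=> H; elim: s => [|i s IH].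
  have := PS_cst n.+1 rho0 1; rewrite normr1 big_nil.
  by apply: PS_eq => y _; rewrite big_nil.
rewrite big_cons; case Pi : (P i).
  by apply: PS_eq (PSM (H _ Pi) IH) => y _; rewrite big_cons Pi.
by apply: PS_eq IH => y _; rewrite big_cons Pi.
Qed.

(** The norm bound [sigma] on the inner functions is the radius at which the outer series is
    summable: a monomial in the [u i] then has norm at most the corresponding weight of [sigma]. *)
Lemma PS_comp (m : nat) (d : ('I_m.+1 -> nat) -> K) (u : 'I_m.+1 -> 'cV[K]_n.+1 -> K)
    (sigma M : K) h :
  (forall k, boxsum k (fun b => `|d b| * wt sigma b) <= M) ->
  (forall i, PS rho sigma (u i)) ->
  (forall y, incube rho y ->
     boxsum k (fun b => d b * mon (\col_i u i y) b) @[k --> \oo] --> h y) ->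
  PS rho M h.
Proof.
move=> HM Hu Hh.
apply: (@PS_boxseries _ _ _ rho0 _ d (fun b y => mon (\col_i u i y) b) (wt sigma)) => // b.
apply: (@PS_eq _ _ _ _ (fun y => \prod_(i < m.+1) u i y ^+ b i)).
  by move=> y _; apply: eq_bigr => i _; rewrite mxE.
by apply: PS_prod => i _; exact: PSX.
Qed.

(** A Schwarz lemma: without constant term, every monomial has positive degree and gains at least
    one factor [s / rho] on the smaller cube. It makes a function vanishing at 0 small in norm. *)
Lemma PS_subradius s M g : 0 < s -> s <= rho -> PS rho M g -> g 0 = 0 ->
  PS s (s / rho * M) g.
Proof.
move=> s0 sr [c [H1 H2]] g0.
(* At the origin the box sums are eventually the constant coefficient, so it equals [g 0] by
   uniqueness of limits. *)
have c0 : c (fun=> 0) = 0.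
  have i0 : incube rho (0 : 'cV[K]_n.+1) by move=> i; rewrite mxE normr0 ltW.
  have := H2 _ i0; rewrite g0 => L.
  have L' : boxsum k (fun a => c a * mon (0 : 'cV[K]_n.+1) a) @[k --> \oo] --> c (fun=> 0).
    apply: cvg_near_cst; near=> k.
    have -> : boxsum k (fun a => c a * mon (0 : 'cV[K]_n.+1) a) =
        boxsum k (fun a => [forall i, a i == 0]%:R * c a).
      apply: eq_boxsum => a; case: forallP => [e|/forallP/forallPn[i ai]].
        rewrite /mon big1 ?mulr1 ?mul1r // => i _; rewrite (eqP (e i)) //.
      by rewrite mul0r /mon (bigD1 i) //= mxE expr0n (negbTE ai) mul0r mulr0.
    rewrite boxsum_delta ifT //; apply/forallP => i; near: k; exact: nbhs_infty_gt.
  exact: (cvg_unique _ L' L).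
exists c; split=> [k|y ys]; last first.
  by apply: H2 => i; apply: le_trans (ys i) sr.
apply: le_trans (ler_wpM2l _ (H1 k)); last by rewrite divr_ge0 // ltW.
rewrite -boxsumZ; apply: boxsum_le => a.
have [->|a0] := pselect (a = fun=> 0); first by rewrite c0 normr0 !mul0r mulr0.
have [i ai] : exists i, (0 < a i)%N.
  apply: contrapT => /forallNP H; apply: a0.
  by apply/funext => i; apply/eqP; rewrite -leqn0 leqNgt; apply/negP; exact: H.
rewrite mulrCA ler_wpM2l // /wt (bigD1 i) //= [X in _ <= _ * X](bigD1 i) //= mulrA.
apply: ler_pM.
- by rewrite exprn_ge0 // ltW.
- by apply: prodr_ge0 => j _; rewrite exprn_ge0 // ltW.
- case: (a i) ai => // j _; rewrite !exprS mulrA divfK ?gt_eqF //.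
  by rewrite ler_wpM2l ?(ltW s0) // lerXn2r // nnegrE ltW.
- by apply: ler_prod => j _; rewrite exprn_ge0 ?(ltW s0) // lerXn2r // nnegrE ltW.
Unshelve. all: by end_near. Qed.

End Products.

(** * Square roots and reciprocals near 1 *)

Section SqrtInv.
Variables (K : realType) (n : nat) (rho : K).
Hypothesis rho0 : 0 < rho.
Implicit Types (s z : 'cV[K]_n.+1 -> K).

Lemma cvg_half_pow (u : nat -> K) (l C : K) :
  (forall J, `|l - u J| <= C * 2^-1 ^+ J) -> u @ \oo --> l.
Proof.
move=> H; apply/cvgrPdist_le => e e0.
have : geometric C 2^-1 @ \oo --> (0 : K).
  by apply: cvg_geometric; rewrite ger0_norm ?invr_ge0 // invf_lt1 // ltr1n.
move/cvgrPdist_le => /(_ _ e0); apply: filterS => J.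
rewrite sub0r normrN => h; apply: le_trans (H J) (le_trans (ler_norm _) h).
Qed.

(* [sqrt (1 + z) - 1] is the fixed point of the contraction [s |-> (z - s^2) / 2]. *)
Lemma PS_sqrt (e : K) z : e <= 4^-1 -> PS rho e z ->
  PS rho e (fun y => Num.sqrt (1 + z y) - 1).
Proof.
move=> e4 ze; have e0 := PS_ge0 rho0 ze.
pose s k := iter k (fun f (y : 'cV[K]_n.+1) => 2^-1 * (z y - f y ^+ 2)) (fun=> 0).
have half : `|2^-1| = 2^-1 :> K by rewrite ger0_norm.
have sPS k : PS rho e (s k).
  elim: k => [|k IH]; first exact: (PS_le e0 (PS0 n.+1 rho)).
  apply: PS_le (PSZ 2^-1 (PSB rho0 ze (PSX rho0 2 IH))).
  by rewrite half; nra.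
have dPS k : PS rho (e / 2 * 2^-1 ^+ k) (fun y => s k.+1 y - s k y).
  elim: k => [|k IH].
    apply: PS_eq (PS_le _ (PSZ 2^-1 ze)) => [y _|].
      by rewrite /s /= expr0n subr0 subr0.
    by rewrite half expr0 mulr1 mulrC.
  (* Each difference is the previous one times minus half the sum of two consecutive iterates, a
     factor of norm at most [e], which is below one half. *)
  apply: PS_eq (PS_le _ (PSZ (- 2^-1) (PSM rho0 (PSD rho0 (sPS k.+1) (sPS k)) IH))) => [y _|].
    by rewrite /s /=; field.
  rewrite normrN half exprS.
  have : 0 <= e / 2 * 2^-1 ^+ k by exact: PS_ge0 IH.
  by move=> X0; rewrite [leRHS]mulrCA; set X := e / 2 * 2^-1 ^+ k in X0 *; nra.
apply: (PS_series rho0 dPS) => [J|y yr].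
  have -> : \sum_(0 <= j < J) e / 2 * 2^-1 ^+ j = e - e * 2^-1 ^+ J.
    elim: J => [|J IH]; first by rewrite big_nil expr0 mulr1 subrr.
    by rewrite big_nat_recr //= IH exprS; field.
  by rewrite lerBlDr lerDl mulr_ge0 // exprn_ge0 // invr_ge0.
set t := Num.sqrt (1 + z y) - 1.
have zb : `|z y| <= 4^-1 by apply: le_trans (PS_bound ze yr) e4.
have q2 : (t + 1) ^+ 2 = 1 + z y.
  by rewrite subrK sqr_sqrtr //; move: zb; rewrite ler_norml; lra.
have q0 : 0 <= t + 1 by rewrite subrK sqrtr_ge0.
(* This says that [t] is a fixed point; it is used to show that the iterates tend to [t] itself, not
   merely to some limit. *)
have zt : z y = t * (t + 2) by rewrite -[z y](addKr 1) -q2; ring.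
have tb : `|t| <= 4^-1.
  apply: le_trans zb; rewrite zt.
  by rewrite normrM ler_peMr // ger0_norm; lra.
apply: (@cvg_half_pow _ _ 1) => J.
rewrite (telescope_sumr (fun j => s j y)) // {2}/s /= subr0 mul1r.
elim: J => [|J IH]; first by rewrite /s /= subr0 expr0; lra.
have -> : t - s J.+1 y = (t - s J y) * (- 2^-1 * (s J y + t)).
  by rewrite /s /= -/(s J) zt; field.
rewrite normrM exprSr; apply: ler_pM => //.
have sb := le_trans (PS_bound (sPS J) yr) e4.
rewrite normrM normrN half ler_piMr ?invr_ge0 //.
by apply: le_trans (ler_normD _ _) _; lra.
Qed.

(** Geometric series in [- s]; the ratio one half gives the bound 2. *)
Lemma PS_inv s : PS rho 2^-1 s -> PS rho 2 (fun y => (1 + s y)^-1).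
Proof.
move=> sPS.
have NPS j : PS rho (2^-1 ^+ j) (fun y => (- s y) ^+ j).
  apply: PSX => //; have := PSZ (-1) sPS; rewrite normrN1 mul1r.
  by apply: PS_eq => y _; rewrite mulN1r.
apply: (PS_series rho0 NPS) => [J|y yr].
  have -> : \sum_(0 <= j < J) 2^-1 ^+ j = 2 - 2 * 2^-1 ^+ J :> K.
    elim: J => [|J IH]; first by rewrite big_nil expr0 mulr1 subrr.
    by rewrite big_nat_recr //= IH exprS; field.
  by rewrite lerBlDr lerDl mulr_ge0 // exprn_ge0 // invr_ge0.
have sb := PS_bound sPS yr.
have s0 : 0 < 1 + s y by move: sb; rewrite ler_norml; lra.
apply: (@cvg_half_pow _ _ 2) => J.
have -> : \sum_(0 <= j < J) (- s y) ^+ j = (1 + s y)^-1 - (1 + s y)^-1 * (- s y) ^+ J.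
  elim: J => [|J IH]; first by rewrite big_nil expr0 mulr1 subrr.
  by rewrite big_nat_recr //= IH exprS; field; rewrite gt_eqF.
rewrite opprB addrCA subrr addr0 normrM normrX normrN.
apply: ler_pM => //; last by rewrite lerXn2r // nnegrE invr_ge0.
rewrite gtr0_norm ?invr_gt0 // invf_ple ?posrE //.
by move: sb; rewrite ler_norml; lra.
Qed.

End SqrtInv.

(** * Real analytic functions *)

Lemma normr_col_lt (n : nat) (y : 'cV[R]_n) (r : R) :
  0 < r -> (forall i, `|y i ord0| < r) -> `|y| < r.
Proof.
move=> r0 H; rewrite [ltLHS]/Num.norm /= mx_normrE; apply/bigmax_ltP; split=> // -[i j] _ /=.
by rewrite ord1; exact: H.
Qed.

Lemma le_normr_col (n : nat) (y : 'cV[R]_n) i : `|y i ord0| <= `|y|.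
Proof.
by rewrite [leRHS]/Num.norm /= mx_normrE; apply/bigmax_geP; right => /=; exists (i, ord0).
Qed.

(** The norm on column vectors is the maximum norm, so its ball of radius [rho] lies in the cube. *)
Lemma PS_analytic (n : nat) (U : set 'cV[R]_n) (g : 'cV[R]_n -> R) :
  (forall p, U p -> exists rho M, 0 < rho /\ PS rho M (fun y => g (p + y))) ->
  real_analytic_on U g.
Proof.
move=> H p Up; have [rho [M [rho0 [c [H1 H2]]]]] := H _ Up.
exists rho => //; exists c => x xp.
have xr : incube rho (x - p) by move=> i; apply: le_trans (le_normr_col _ i) (ltW xp).
split; last by have := H2 _ xr; rewrite [p + _]addrC subrK.
exists M => k; apply: le_trans (H1 k); apply: ler_sum => al _; apply: ler_wpM2l => //.
apply: le_trans (mon_le_wt _ xr); rewrite /mon normr_prod.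
by apply: ler_prod => i _; rewrite exprn_ge0 //= normrX.
Qed.

(** Absolute convergence at the corner p + (s, ..., s) of the cube amounts to finiteness of the norm
    with weight [s]. The coefficients do not depend on [s], which can thus be chosen later. *)
Lemma analytic_PS (n : nat) (U : set 'cV[R]_n) (g : 'cV[R]_n -> R) (p : 'cV[R]_n) :
  real_analytic_on U g -> U p -> exists2 r : R, 0 < r &
  exists c : ('I_n -> nat) -> R, forall s : R, 0 < s < r ->
    (exists M, forall k, boxsum k (fun a => `|c a| * wt s a) <= M) /\
    (forall y, incube s y -> boxsum k (fun a => c a * mon y a) @[k --> \oo] --> g (p + y)).
Proof.
move=> H Up; have [r r0 [c Hc]] := H _ Up.
exists r => //; exists c => s /andP[s0 sr]; split; last first.
  move=> y ys; have /Hc[_] : `|(p + y) - p| < r.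
    by rewrite addrAC subrr add0r; apply: normr_col_lt => // i; exact: le_lt_trans (ys i) sr.
  by rewrite addrAC subrr add0r.
have /Hc[[M HM] _] : `|(p + const_mx s) - p| < r.
  by rewrite addrAC subrr add0r; apply: normr_col_lt => // i; rewrite mxE gtr0_norm.
exists M => k; apply: le_trans (HM k); apply: ler_sum => al _; apply: ler_wpM2l => //.
rewrite addrAC subrr add0r; apply: ler_prod => i _.
by rewrite exprn_ge0 ?(ltW s0) //= mxE gtr0_norm.
Qed.

Lemma mon2E (s t : R) b : mon (vec2 s t) b = s ^+ b (inord 0) * t ^+ b (inord 1).
Proof.
rewrite /mon !big_ord_recl big_ord0 mulr1 !mxE /=.
by congr (_ ^+ b _ * _ ^+ b _); apply/val_inj; rewrite /= inordK.
Qed.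

Lemma wt2E (s : R) (b : 'I_2 -> nat) : wt s b = s ^+ b (inord 0) * s ^+ b (inord 1).
Proof.
rewrite /wt !big_ord_recl big_ord0 mulr1.
by congr (_ ^+ b _ * _ ^+ b _); apply/val_inj; rewrite /= inordK.
Qed.

Lemma vc2_vec2 (a b : R) : (vc2 (vec2 a b) 0 = a) * (vc2 (vec2 a b) 1 = b).
Proof. by rewrite /vc2 !mxE !inordK. Qed.

Lemma vec2D (a b : R) (y : 'cV[R]_2) : vec2 a b + y = vec2 (a + vc2 y 0) (b + vc2 y 1).
Proof.
apply/matrixP => i j; rewrite !mxE ord1.
case: i => [[|[|//]] H] /=; rewrite /vc2; congr (_ + y _ _); apply/val_inj;
  by rewrite /= inordK.
Qed.

Lemma vcE (v : 'cV[R]_4) (i : 'I_4) : vc v i = v i ord0.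
Proof. by rewrite /vc inord_val. Qed.

Lemma vcD (p y : 'cV[R]_4) i : vc (p + y) i = vc p i + vc y i.
Proof. by rewrite /vc mxE. Qed.

Lemma vc_vec4 (a b c d : R) : (vc (vec4 a b c d) 0 = a) * (vc (vec4 a b c d) 1 = b) *
  (vc (vec4 a b c d) 2 = c) * (vc (vec4 a b c d) 3 = d).
Proof. by rewrite /vc !mxE !inordK. Qed.

Lemma open_square (D : set (R * R)) (a b : R) : open D -> D (a, b) ->
  exists2 d : R, 0 < d & forall s t : R, `|s - a| < d -> `|t - b| < d -> D (s, t).
Proof.
move=> oD Dab; have := open_nbhs_nbhs (conj oD Dab).
move=> /nbhs_ballP[d /= d0 dD]; exists d => // s t sa tb; apply: dD; split => /=.
  by rewrite /ball /= distrC.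
by rewrite /ball /= distrC.
Qed.

Lemma incube_vec2 (s a b : R) : `|a| <= s -> `|b| <= s -> incube s (vec2 a b).
Proof. by move=> ha hb i; rewrite mxE; case: i => [[|[|//]] H]. Qed.

Lemma radv_ge0 v : 0 <= radv v.
Proof. exact: sqrtr_ge0. Qed.

Lemma radv_sqr v : radv v ^+ 2 = vc v 1 ^+ 2 + vc v 2 ^+ 2 + vc v 3 ^+ 2.
Proof. by rewrite sqr_sqrtr // !addr_ge0 // sqr_ge0. Qed.

Lemma ord4_cases (h : 'I_4) : [\/ h = oi 0, h = oi 1, h = oi 2 | h = oi 3].
Proof.
by case: h => [[|[|[|[|//]]]] H]; [constructor 1|constructor 2|constructor 3|constructor 4];
  apply/val_inj; rewrite /= inordK.
Qed.

Lemma vc_oi v k : (k < 4)%N -> vc v (oi k) = vc v k.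
Proof. by move=> k4; rewrite /oi inordK. Qed.

Lemma oi_neq0 k : (0 < k < 4)%N -> oi k != oi 0.
Proof. by move=> /andP[k0 k4]; rewrite -val_eqE /= !inordK // -lt0n. Qed.

Lemma sqr_vc_le_radv v (h : 'I_4) : h != oi 0 -> vc v h ^+ 2 <= radv v ^+ 2.
Proof.
rewrite radv_sqr; have := (sqr_ge0 (vc v 1), sqr_ge0 (vc v 2), sqr_ge0 (vc v 3)).
by case: (ord4_cases h) => ->; rewrite ?eqxx // vc_oi // => -[[]]; lra.
Qed.

Lemma radv_eq0_vc v (h : 'I_4) : h != oi 0 -> radv v = 0 -> vc v h = 0.
Proof.
move=> h0 v0; have := sqr_vc_le_radv v h0; rewrite v0 expr0n /= => H.
by apply/eqP; rewrite -sqrf_eq0 eq_le H sqr_ge0.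
Qed.

Lemma radv_eq0_vcn v k : (0 < k < 4)%N -> radv v = 0 -> vc v k = 0.
Proof.
move=> k04; have /andP[_ k4] := k04; rewrite -(vc_oi v k4).
exact: radv_eq0_vc (oi_neq0 k04).
Qed.

(** * Analyticity of radial extensions *)

Section Radial.
Variables (D : set (R * R)) (phi : R * R -> R) (odd_phi : bool) (h : 'I_4).
Variable g : 'cV[R]_4 -> R.
Hypotheses (oD : open D) (h0 : h != oi 0).
Hypothesis parity : forall a b, D (a, b) -> phi (a, - b) = (-1) ^+ odd_phi * phi (a, b).
Hypothesis phiA :
  real_analytic_on [set y | D (vc2 y 0, vc2 y 1)] (fun y => phi (vc2 y 0, vc2 y 1)).
Hypothesis gE : forall v, Eset D v ->
  g v = (vc v h / radv v) ^+ odd_phi * phi (vc v 0, radv v).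

Lemma phi_expansion a b : D (a, b) -> exists (s M : R) (c : ('I_2 -> nat) -> R),
  [/\ 0 < s,
      forall x y, `|x| <= s -> `|y| <= s -> D (a + x, b + y),
      forall k, boxsum k (fun i => `|c i| * wt s i) <= M &
      forall x y, `|x| <= s -> `|y| <= s ->
        boxsum k (fun i => c i * mon (vec2 x y) i) @[k --> \oo] --> phi (a + x, b + y)].
Proof.
move=> Dab; have Dq : [set y | D (vc2 y 0, vc2 y 1)] (vec2 a b) by rewrite /= !vc2_vec2.
have [r r0 [c Hc]] := analytic_PS phiA Dq.
have [d d0 Hd] := open_square oD Dab.
pose s := Num.min r d / 2.
have m0 : 0 < Num.min r d by rewrite lt_min r0.
have s0 : 0 < s by rewrite divr_gt0.
have sm : s < Num.min r d by rewrite /s; lra.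
have [sr sd] : s < r /\ s < d by move: sm; rewrite lt_min => /andP.
have /Hc[[M HM] Hcv] : 0 < s < r by rewrite s0.
exists s, M, c; split=> // x y xs ys.
  by apply: Hd; rewrite addrAC subrr add0r; exact: le_lt_trans sd.
by have := Hcv _ (incube_vec2 xs ys); rewrite vec2D !vc2_vec2.
Qed.

(** With r the radius at [p], the radius at [p + y] is r times sqrt (1 + z) for a polynomial z
    vanishing at 0. On a small cube the square root and its reciprocal have finite norm, and the
    expansion of [phi] can be composed with them. *)
Lemma radial_PS_pos p : Eset D p -> 0 < radv p ->
  exists rho M, 0 < rho /\ PS rho M (fun y => g (p + y)).
Proof.
move=> Ep; set r := radv p => r0.
have [s [M [c [s0 Ds HM Hcv]]]] := phi_expansion Ep.
pose z (y : 'cV[R]_4) : R :=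
  (r ^+ 2)^-1 * ((vc p 1 + vc y 1) ^+ 2 + (vc p 2 + vc y 2) ^+ 2 + (vc p 3 + vc y 3) ^+ 2) - 1.
have [Mz zPS] : exists M, PS 1 M z.
  have sq k := PSX ltr01 2 (PSD ltr01 (PS_cst 4 ltr01 (vc p k)) (PS_coord ltr01 (inord k))).
  eexists; exact: (PSB ltr01 (PSZ (r ^+ 2)^-1 (PSD ltr01 (PSD ltr01 (sq 1%N) (sq 2%N)) (sq 3%N)))
    (PS_cst 4 ltr01 1)).
have r20 : r ^+ 2 != 0 by rewrite sqrf_eq0 gt_eqF.
have z0 : z 0 = 0.
  by rewrite /z /vc !mxE !addr0 -!/(vc p _) -radv_sqr mulVf ?subrr.
have Mz0 := PS_ge0 ltr01 zPS.
(* One quarter is what the square root requires; [s / r] keeps the increment of the radius within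
   the cube where [phi] is expanded. *)
pose e := Num.min 4^-1 (s / r).
have e0 : 0 < e by rewrite lt_min invr_gt0 ltr0n divr_gt0.
have e4 : e <= 4^-1 by rewrite ge_min lexx.
have es : r * e <= s by rewrite mulrC -ler_pdivlMr // ge_min lexx orbT.
(* The bounds serve, in order, the cube on which [z] was estimated, the first argument of [phi], and
   the reduction of the norm of [z] to [e]; adding 1 to [Mz] keeps the denominator positive. *)
pose rho := Num.min 1 (Num.min s (e / (Mz + 1))).
have Mz1 : 0 < Mz + 1 by lra.
have rho0 : 0 < rho by rewrite !lt_min ltr01 s0 divr_gt0.
have rho1 : rho <= 1 by rewrite ge_min lexx.
have rhos : rho <= s by rewrite !ge_min lexx orbT.
have rhoe : rho * (Mz + 1) <= e by rewrite -ler_pdivlMr // !ge_min lexx !orbT.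
have zPS' : PS rho e z.
  apply: PS_le (PS_subradius ltr01 rho0 rho1 zPS z0); rewrite divr1; nra.
pose t y : R := Num.sqrt (1 + z y) - 1.
have tPS : PS rho e t by exact: PS_sqrt.
have radE y : radv (p + y) = r * (1 + t y).
  have -> : 1 + t y = Num.sqrt (1 + z y) by rewrite /t; ring.
  have -> : 1 + z y = (r ^+ 2)^-1 * radv (p + y) ^+ 2.
    by rewrite radv_sqr !vcD /z; ring.
  by rewrite sqrtrM ?invr_ge0 ?sqr_ge0 // sqrtrV ?sqr_ge0 // !sqrtr_sqr !ger0_norm
    ?radv_ge0 // mulrA mulfV ?mul1r // gt_eqF.
pose u (i : 'I_2) y : R := nth 0 [:: vc y 0; r * t y] i.
have uPS i : PS rho s (u i).
  case: i => [[|[|//]] H]; rewrite /u /=.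
    exact: (PS_le rhos (PS_coord rho0 (inord 0))).
  by apply: PS_le (PSZ r tPS); rewrite gtr0_norm.
have ub y i : incube rho y -> `|u i y| <= s by exact: PS_bound.
have inD y : incube rho y -> D (vc p 0 + vc y 0, r + r * t y).
  by move=> yr; apply: Ds; [have := ub y ord0 yr | have := ub y (lift ord0 ord0) yr].
have phiPS : PS rho M (fun y => phi (vc p 0 + vc y 0, r + r * t y)).
  apply: (PS_comp rho0 HM uPS) => y yr.
  by apply: Hcv; [have := ub y ord0 yr | have := ub y (lift ord0 ord0) yr].
have half : e <= 2^-1 by lra.
have facPS := PSX rho0 odd_phi (PSM rho0
  (PSD rho0 (PS_cst 4 rho0 (vc p h)) (PS_coord rho0 h))
  (PSZ r^-1 (PS_inv rho0 (PS_le half tPS)))).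
exists rho; eexists; split=> //; apply: PS_eq (PSM rho0 facPS phiPS) => y yr.
have E : radv (p + y) = r + r * t y by rewrite radE mulrDr mulr1.
rewrite gE; last by rewrite /Eset /= vcD E; exact: inD.
by rewrite E !vcD vcE -E radE invfM (vcE y h).
Qed.

(* At a point of the real axis only the monomials of the right parity in the
   second variable survive, and an even power of the radius is a polynomial. *)
Lemma radial_PS_zero p : Eset D p -> radv p = 0 ->
  exists rho M, 0 < rho /\ PS rho M (fun y => g (p + y)).
Proof.
move=> Ep r0; move: (Ep); rewrite /Eset /= r0 => Dp.
have [s [M [c [s0 Ds HM Hcv]]]] := phi_expansion Dp.
(* Then [3 * rho ^+ 2 <= s ^+ 2], so the radius, and the polynomial standing for its square, stay in
   the range of the expansion. *)
pose rho := s / 2; have rho0 : 0 < rho by rewrite divr_gt0.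
pose i0 : 'I_2 := inord 0; pose i1 : 'I_2 := inord 1.
pose c' (b : 'I_2 -> nat) : R := if odd (b i1) == odd_phi then c b else 0.
pose w (y : 'cV[R]_4) : R := vc y 1 ^+ 2 + vc y 2 ^+ 2 + vc y 3 ^+ 2.
have ph : vc p h = 0 by apply: radv_eq0_vc.
have pv k k4 := @radv_eq0_vcn p k k4 r0.
have radE y : radv (p + y) ^+ 2 = w y.
  by rewrite radv_sqr !vcD (pv 1%N) // (pv 2%N) // (pv 3%N) // !add0r.
have wPS : PS rho (3 * rho ^+ 2) w.
  have sq k := PSX rho0 2 (PS_coord rho0 (inord k : 'I_4)).
  apply: PS_le (PSD rho0 (PSD rho0 (sq 1%N) (sq 2%N)) (sq 3%N)); lra.
exists rho, M; split=> //.
(* When [b i1] has the parity of [odd_phi], this is the monomial in the radius times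
   [(vc y h / r) ^+ odd_phi], with the division carried out. *)
pose G (b : 'I_2 -> nat) (y : 'cV[R]_4) : R :=
  vc y 0 ^+ b i0 * w y ^+ (b i1)./2 * vc y h ^+ odd_phi.
pose N (b : 'I_2 -> nat) : R := rho ^+ b i0 * (3 * rho ^+ 2) ^+ (b i1)./2 * rho ^+ odd_phi.
have rs : rho <= s by rewrite /rho; lra.
apply: (@PS_boxseries _ _ _ rho0 _ c' G N) => [b|k|y yr].
- apply: PSM => //; last first.
    by apply: PS_eq (PSX rho0 odd_phi (PS_coord rho0 h)) => y _; rewrite vcE.
  by apply: PSM => //; apply: PSX => //; exact: PS_coord.
- apply: le_trans (HM k); apply: boxsum_le => b; rewrite /c'.
  case: eqP => [ob|_]; last by rewrite normr0 mul0r mulr_ge0 // wt_ge0 // ltW.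
  apply: ler_wpM2l => //; rewrite wt2E /N -mulrA -/i0 -/i1.
  have rn : rho \is Num.nneg by rewrite nnegrE ltW.
  have sn : s \is Num.nneg by rewrite nnegrE ltW.
  have r3 : 0 <= 3 * rho ^+ 2 by rewrite mulr_ge0 // sqr_ge0.
  apply: ler_pM; rewrite ?exprn_ge0 ?mulr_ge0 ?exprn_ge0 ?(ltW rho0) ?lerXn2r //.
  rewrite -[X in _ <= _ ^+ X](odd_double_half (b i1)) ob exprD mulrC -mul2n exprM.
  apply: ler_pM; rewrite ?exprn_ge0 ?(ltW rho0) ?lerXn2r ?nnegrE ?sqr_ge0 //.
  by rewrite /rho; nra.
pose r : R := radv (p + y).
have yi i : `|y i ord0| <= rho by exact: yr.
have rb : `|r| <= s.
  rewrite ger0_norm ?radv_ge0 // -ler_sqr ?nnegrE ?radv_ge0 ?(ltW s0) // radE.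
  have /andP[_ wb] : - (3 * rho ^+ 2) <= w y <= 3 * rho ^+ 2.
    by rewrite -ler_norml; exact: PS_bound wPS yr.
  by apply: le_trans wb _; rewrite /rho; nra.
have y0s : `|vc y 0| <= s by apply: le_trans rs; exact: yi.
have rNb : `|- r| <= s by rewrite normrN.
have := Ds _ _ y0s rb; rewrite add0r => Dr.
have EpE : Eset D (p + y) by rewrite /Eset /= vcD -/r.
have := Hcv _ _ y0s rb; have := Hcv _ _ y0s rNb; rewrite !add0r parity // => L1 L2.
pose q : R := (vc (p + y) h / r) ^+ odd_phi.
rewrite gE // -/r -/q vcD.
(* The expansions at r and -r are averaged with the sign [(-1) ^+ odd_phi]: terms of the wrong
   parity cancel, the others are kept. *)
apply: (@cvgn_lincomb R _ _ _ (q / 2) (q / 2 * (-1) ^+ odd_phi) _ _ _ L2 L1) => [k|]; last first.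
  by rewrite mulrA -[_ * _ * (-1) ^+ _]mulrA -signr_addb addbb expr0; field.
rewrite -!boxsumZ -boxsumD; apply: eq_boxsum => b; rewrite !mon2E -/i0 -/i1 /c' /G.
(* This survives r = 0, because [vc y h] vanishes there as well. *)
have yh : vc y h ^+ odd_phi = q * r ^+ odd_phi.
  rewrite /q -exprMn; congr (_ ^+ _); rewrite vcD ph add0r.
  have [rz|rnz] := eqVneq r 0; last by rewrite divfK.
  by rewrite rz mulr0; have := radv_eq0_vc h0 rz; rewrite vcD ph add0r.
rewrite yh -radE -/r (exprNn r); set j := b i1.
have rj : r ^+ j = (r ^+ 2) ^+ j./2 * r ^+ odd j.
  by rewrite -exprM mul2n -exprD addnC odd_double_half.
have sj : (-1) ^+ j = (-1) ^+ odd j :> R by rewrite signr_odd.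
case: eqP => [ob|/eqP ob]; rewrite rj sj.
  by rewrite ob; case: (odd_phi); rewrite ?expr0 ?expr1; field.
have -> : odd j = ~~ odd_phi by case: (odd j) (odd_phi) ob => [] [].
by case: (odd_phi); rewrite /= ?expr0 ?expr1; field.
Qed.

(** The even case serves the component of index 0 and the odd case the other three. The axis is
    treated apart because the radius is not analytic there. *)
Lemma radial_analytic : real_analytic_on (Eset D) g.
Proof.
apply: PS_analytic => p Ep; have [r0|rn0] := eqVneq (radv p) 0.
  exact: radial_PS_zero.
by apply: radial_PS_pos => //; rewrite lt_def rn0 radv_ge0.
Qed.

End Radial.

(** The expansion of [g] is composed with the embedding of the plane, whose last two coordinates are
    the zero function. For negative [b] the base point is in E by the symmetry of [D]. *)
Lemma restriction_analytic (D : set (R * R)) (f : R * R -> R) (g : 'cV[R]_4 -> R) :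
  open D -> (forall a b, D (a, b) -> D (a, - b)) ->
  (forall a b, D (a, b) -> f (a, b) = g (vec4 a b 0 0)) ->
  real_analytic_on (Eset D) g ->
  real_analytic_on [set y | D (vc2 y 0, vc2 y 1)] (fun y => f (vc2 y 0, vc2 y 1)).
Proof.
move=> oD Dsym fg gA; apply: PS_analytic => p /= Dp.
set a := vc2 p 0 in Dp *; set b := vc2 p 1 in Dp *.
have Ep : Eset D (vec4 a b 0 0).
  rewrite /Eset /= /radv !vc_vec4 expr0n /= !addr0 sqrtr_sqr.
  by case: (ger0P b) => // _; exact: Dsym.
have [r r0 [c Hc]] := analytic_PS gA Ep.
have [d d0 Hd] := open_square oD Dp.
pose s := Num.min r d / 2.
have m0 : 0 < Num.min r d by rewrite lt_min r0.
have s0 : 0 < s by rewrite divr_gt0.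
have sm : s < Num.min r d by rewrite /s; lra.
have [sr sd] : s < r /\ s < d by move: sm; rewrite lt_min => /andP.
have /Hc[[M HM] Hcv] : 0 < s < r by rewrite s0.
exists s, M; split=> //.
pose u (i : 'I_4) (y : 'cV[R]_2) : R := nth 0 [:: vc2 y 0; vc2 y 1; 0; 0] i.
have uPS i : PS s s (u i).
  case: i => [[|[|[|[|//]]]] H]; rewrite /u /=; try exact: PS_coord.
    exact: (PS_le (ltW s0) (PS0 2 s)).
  exact: (PS_le (ltW s0) (PS0 2 s)).
apply: (PS_comp s0 HM uPS) => y ys; rewrite /= /vc2 !mxE -/a -/b.
have ys' : incube s (\col_i u i y) by move=> i; rewrite mxE; exact: PS_bound (uPS i) ys.
have -> : f (vc2 p 0 + y (inord 0) ord0, vc2 p 1 + y (inord 1) ord0) =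
    g (vec4 a b 0 0 + \col_i u i y).
  rewrite fg.
    congr g; apply/matrixP => i j; rewrite !mxE /u.
    by case: i => [[|[|[|[|//]]]] H] //=; rewrite addr0.
  by apply: Hd; rewrite addrAC subrr add0r; exact: le_lt_trans (ys _) sd.
exact: Hcv.
Qed.

(** * Octonions *)

Lemma qcD x y n : qc (x + y) n = qc x n + qc y n. Proof. exact: mxE. Qed.
Lemma qcN x n : qc (- x) n = - qc x n. Proof. exact: mxE. Qed.
Lemma qcZ a x n : qc (a *: x) n = a * qc x n. Proof. exact: mxE. Qed.
Lemma qc0 n : qc 0 n = 0. Proof. exact: mxE. Qed.
Lemma qc_mk a b c d : (qc (qmk a b c d) 0 = a) * (qc (qmk a b c d) 1 = b) *
  (qc (qmk a b c d) 2 = c) * (qc (qmk a b c d) 3 = d).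
Proof. by rewrite /qc !mxE !inordK. Qed.
Definition qcE := (qcD, qcN, qcZ, qc0, qc_mk).

Lemma quat_ext (x y : quat) : qc x 0 = qc y 0 -> qc x 1 = qc y 1 -> qc x 2 = qc y 2 ->
  qc x 3 = qc y 3 -> x = y.
Proof.
move=> e0 e1 e2 e3; apply/matrixP => i j; rewrite ord1 -(inord_val j).
by case: j => [[|[|[|[|//]]]] H].
Qed.

Lemma oct_ext (x y : oct) : qc x.1 0 = qc y.1 0 -> qc x.1 1 = qc y.1 1 ->
  qc x.1 2 = qc y.1 2 -> qc x.1 3 = qc y.1 3 -> qc x.2 0 = qc y.2 0 -> qc x.2 1 = qc y.2 1 ->
  qc x.2 2 = qc y.2 2 -> qc x.2 3 = qc y.2 3 -> x = y.
Proof. by case: x y => [a b] [c d] /= *; congr pair; exact: quat_ext. Qed.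

Definition re (x : oct) : R := qc x.1 0.

Lemma odotE x y : odot x y =
  qc x.1 0 * qc y.1 0 + qc x.1 1 * qc y.1 1 + qc x.1 2 * qc y.1 2 + qc x.1 3 * qc y.1 3 +
  qc x.2 0 * qc y.2 0 + qc x.2 1 * qc y.2 1 + qc x.2 2 * qc y.2 2 + qc x.2 3 * qc y.2 3.
Proof. by rewrite /odot !big_ord_recl big_ord0 addr0 !addrA. Qed.

Ltac oct_ring := apply: oct_ext; rewrite /omul /qmul /qconj /oone /= !qcE; ring.

Lemma omulDl x y z : omul (x + y) z = omul x z + omul y z. Proof. by oct_ring. Qed.
Lemma omulZl a x y : omul (a *: x) y = a *: omul x y. Proof. by oct_ring. Qed.
Lemma omulZr a x y : omul x (a *: y) = a *: omul x y. Proof. by oct_ring. Qed.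

(** The quadratic equation satisfied by every octonion. *)
Lemma omul_sqr x : omul x x = (2 * re x) *: x - odot x x *: oone.
Proof.
by rewrite odotE /re; apply: oct_ext; rewrite /omul /qmul /qconj /oone /= !qcE; ring.
Qed.

Lemma reD x y : re (x + y) = re x + re y. Proof. exact: qcD. Qed.
Lemma reN x : re (- x) = - re x. Proof. exact: qcN. Qed.
Lemma reZ a x : re (a *: x) = a * re x. Proof. exact: qcZ. Qed.
Lemma re1 : re oone = 1. Proof. by rewrite /re qc_mk. Qed.

Lemma odotC x y : odot x y = odot y x.
Proof. by rewrite !odotE; ring. Qed.
Lemma odotDl x y z : odot (x + y) z = odot x z + odot y z.
Proof. by rewrite !odotE /= !qcE; ring. Qed.
Lemma odotZl a x z : odot (a *: x) z = a * odot x z.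
Proof. by rewrite !odotE /= !qcE; ring. Qed.
Lemma odotDr x y z : odot z (x + y) = odot z x + odot z y.
Proof. by rewrite !(odotC z) odotDl. Qed.
Lemma odotZr a x z : odot z (a *: x) = a * odot z x.
Proof. by rewrite !(odotC z) odotZl. Qed.
Lemma odot1l x : odot oone x = re x.
Proof. by rewrite odotE /oone /= !qcE /re; ring. Qed.
Lemma odot_ge0 x : 0 <= odot x x.
Proof. by rewrite odotE !addr_ge0 // -expr2 sqr_ge0. Qed.

Lemma re_omul x y : re (omul x y) = 2 * re x * re y - odot x y.
Proof. by rewrite odotE /re /omul /qmul /qconj /= !qcE; ring. Qed.
(** Degen's eight-square identity: the norm is multiplicative. *)
Lemma odot_omul_omul x y : odot (omul x y) (omul x y) = odot x x * odot y y.
Proof. by rewrite !odotE /omul /qmul /qconj /= !qcE; ring. Qed.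
Lemma odot_omull x y : odot x (omul x y) = odot x x * re y.
Proof. by rewrite !odotE /re /omul /qmul /qconj /= !qcE; ring. Qed.
Lemma odot_omulr x y : odot y (omul x y) = odot y y * re x.
Proof. by rewrite !odotE /re /omul /qmul /qconj /= !qcE; ring. Qed.

(** In the quadratic equation, pairing with [I] gives [re I * (odot I I + 1) = 0], so the real part
    vanishes; taking real parts then gives norm 1. *)
Lemma SphP I : Sph I <-> re I = 0 /\ odot I I = 1.
Proof.
rewrite /Sph /= omul_sqr; split=> [e|[-> ->]]; last first.
  by rewrite mulr0 scale0r scale1r sub0r.
have e1 : 2 * re I * re I - odot I I = - 1.
  by have := congr1 re e; rewrite reD !reN !reZ re1 mulr1.
have : odot I (2 * re I *: I - odot I I *: oone) = odot I (- oone) by rewrite e.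
rewrite -scaleNr -[- oone]scaleN1r odotDr !odotZr (odotC I oone) odot1l => e2.
have e3 : re I * (odot I I + 1) = 0 by lra.
have I0 := odot_ge0 I.
have r0 : re I = 0 by move/eqP: e3; rewrite mulf_eq0 => /orP[/eqP //|/eqP]; lra.
by split=> //; move: e1; rewrite r0; lra.
Qed.

Definition ocomb (x1 x2 x3 : R) (I J : oct) : oct := x1 *: I + x2 *: J + x3 *: omul I J.

(** [I], [J] and their product are orthonormal and purely imaginary, by the formulas for products
    above. *)
Lemma ocomb_frame x1 x2 x3 I J : Nset (I, J) ->
  re (ocomb x1 x2 x3 I J) = 0 /\
  odot (ocomb x1 x2 x3 I J) (ocomb x1 x2 x3 I J) = x1 ^+ 2 + x2 ^+ 2 + x3 ^+ 2.
Proof.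
case=> /= /SphP[rI nI] [/SphP[rJ nJ] IJ].
have rIJ : re (omul I J) = 0 by rewrite re_omul rI IJ; ring.
have nIJ : odot (omul I J) (omul I J) = 1 by rewrite odot_omul_omul nI nJ mulr1.
have I_IJ : odot I (omul I J) = 0 by rewrite odot_omull rJ mulr0.
have J_IJ : odot J (omul I J) = 0 by rewrite odot_omulr rI mulr0.
rewrite /ocomb !reD !reZ rI rJ rIJ !odotDl !odotDr !odotZl !odotZr.
rewrite nI nJ nIJ (odotC J I) (odotC (omul I J) I) (odotC (omul I J) J) IJ I_IJ J_IJ.
by split; ring.
Qed.

(** The coordinates of [I] along i and j are rotated by a right angle and normalised; if both
    vanish, i itself is orthogonal to [I]. *)
Lemma ex_orthogonal_unit I : Sph I -> exists J, Nset (I, J).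
Proof.
move=> SI; have /SphP[rI _] := SI.
pose a := qc I.1 1; pose b := qc I.1 2.
have J0 (c d : R) : c ^+ 2 + d ^+ 2 = 1 -> a * c + b * d = 0 -> Nset (I, (qmk 0 c d 0, 0)).
  move=> n1 o; split=> //=; split; first apply/SphP; rewrite /re /= odotE /= !qcE.
    by split=> //; rewrite -[RHS]n1; ring.
  by rewrite -[RHS]o /a /b; ring.
have [ab0|abn0] := eqVneq (a ^+ 2 + b ^+ 2) 0.
  exists (qmk 0 1 0 0, 0); apply: J0; first by rewrite expr1n expr0n addr0.
  have a0 : a ^+ 2 = 0 by have := (sqr_ge0 a, sqr_ge0 b) => -[]; lra.
  by move/eqP: a0; rewrite sqrf_eq0 => /eqP ->; ring.
pose n := Num.sqrt (a ^+ 2 + b ^+ 2).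
have n2 : n ^+ 2 = a ^+ 2 + b ^+ 2 by rewrite sqr_sqrtr // addr_ge0 // sqr_ge0.
have n0 : n != 0 by rewrite -sqrf_eq0 n2.
exists (qmk 0 (- b / n) (a / n) 0, 0); apply: J0; last by field.
have -> : (- b / n) ^+ 2 + (a / n) ^+ 2 = (a ^+ 2 + b ^+ 2) / n ^+ 2 by field.
by rewrite -n2 divff // sqrf_eq0.
Qed.

(** * O(3)-stem functions *)

Lemma vcN (v : 'cV[R]_4) k : vc (- v) k = - vc v k.
Proof. by rewrite /vc mxE. Qed.

Lemma vec4_eta (v : 'cV[R]_4) : v = vec4 (vc v 0) (vc v 1) (vc v 2) (vc v 3).
Proof.
apply/matrixP => i j; rewrite ord1 mxE -{1}(inord_val i).
by case: i => [[|[|[|[|//]]]] H].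
Qed.

Lemma vec4_mulmx_axis (A : 'M[R]_4) a b i :
  (A *m vec4 a b 0 0) i ord0 = A i (oi 0) * a + A i (oi 1) * b.
Proof.
rewrite mxE !big_ord_recl big_ord0 !mxE /= !mulr0 !addr0.
by congr (A i _ * a + A i _ * b); apply/val_inj; rewrite /= inordK.
Qed.

Lemma act4E (A : 'M[R]_4) w i : act4 A w i =
  A i (oi 0) *: w (oi 0) + A i (oi 1) *: w (oi 1) + A i (oi 2) *: w (oi 2) + A i (oi 3) *: w (oi 3).
Proof.
rewrite /act4 !big_ord_recl big_ord0 addr0 !addrA.
by congr (A i _ *: w _ + A i _ *: w _ + A i _ *: w _ + A i _ *: w _);
  apply/val_inj; rewrite /= inordK.
Qed.

Lemma tr_mul_vcE (x y : 'cV[R]_4) : x^T *m y =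
  (vc x 0 * vc y 0 + vc x 1 * vc y 1 + vc x 2 * vc y 2 + vc x 3 * vc y 3)%:M.
Proof.
apply/matrixP => i j; rewrite !ord1 !mxE eqxx mulr1n !big_ord_recl big_ord0 addr0 !addrA !mxE.
by congr (x _ _ * y _ _ + x _ _ * y _ _ + x _ _ * y _ _ + x _ _ * y _ _);
  apply/val_inj; rewrite /= inordK.
Qed.

Lemma O3_col0 (A : 'M[R]_4) i : O3 A -> A i (oi 0) = (i == oi 0)%:R.
Proof.
move=> [_ /(congr1 (fun B : 'cV[R]_4 => B i ord0))].
rewrite vec4_mulmx_axis mulr1 mulr0 addr0 mxE => ->.
by case: (ord4_cases i) => ->; rewrite /oi -val_eqE /= !inordK.
Qed.

Definition sgmx (a b c : R) : 'M[R]_4 := diag_mx (\row_i nth 0 [:: 1; a; b; c] i).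

Lemma sgmx_vec4 a b c x0 x1 x2 x3 :
  sgmx a b c *m vec4 x0 x1 x2 x3 = vec4 x0 (a * x1) (b * x2) (c * x3).
Proof.
rewrite mul_diag_mx; apply/matrixP => i j; rewrite !mxE.
by case: i => [[|[|[|[|//]]]] H] //=; rewrite mul1r.
Qed.

Lemma sgmx_O3 a b c : a ^+ 2 = 1 -> b ^+ 2 = 1 -> c ^+ 2 = 1 -> O3 (sgmx a b c).
Proof.
move=> ha hb hc; split; last by rewrite sgmx_vec4 !mulr0.
rewrite /sgmx tr_diag_mx mulmx_diag; apply/matrixP => i j; rewrite !mxE.
congr (_ *+ _); case: i => [[|[|[|[|//]]]] H] /=; rewrite -?expr2 ?expr1n //.
Qed.

Lemma act4_sgmx a b c w i : act4 (sgmx a b c) w i = nth 0 [:: 1; a; b; c] i *: w i.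
Proof.
rewrite /act4 (bigD1 i) //= big1 ?addr0 => [|j /negbTE ji]; rewrite !mxE ?eqxx //.
by rewrite eq_sym ji scale0r.
Qed.

Lemma oct_eqN (x : oct) : x = - x -> x = 0.
Proof.
move=> e; have : 2 *: x = 0 by rewrite scaler_nat mulr2n {2}e subrr.
by move/eqP; rewrite scaler_eq0 pnatr_eq0 => /eqP.
Qed.

Lemma radv_axis a b : radv (vec4 a b 0 0) = `|b|.
Proof. by rewrite /radv !vc_vec4 expr0n /= !addr0 sqrtr_sqr. Qed.

(* The Householder reflection swapping [v] and its axis representative. *)
Lemma ex_O3_axis (v : 'cV[R]_4) :
  exists2 A, O3 A & v = A *m vec4 (vc v 0) (radv v) 0 0.
Proof.
set w := vec4 _ _ _ _; pose u := v - w.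
have [u0|un0] := eqVneq u 0.
  exists 1%:M; first by split; rewrite ?trmx1 mul1mx.
  by rewrite mul1mx; apply/eqP; rewrite -subr_eq0 -/u u0.
pose n := vc u 1 ^+ 2 + vc u 2 ^+ 2 + vc u 3 ^+ 2.
have uE : [/\ vc u 0 = 0, vc u 1 = vc v 1 - radv v, vc u 2 = vc v 2 & vc u 3 = vc v 3].
  by rewrite /u /w; split; rewrite vcD vcN !vc_vec4; ring.
have [uc0 uc1 uc2 uc3] := uE.
have n0 : n != 0.
  apply: contra un0 => /eqP n0.
  have := (sqr_ge0 (vc u 1), sqr_ge0 (vc u 2), sqr_ge0 (vc u 3)) => -[[p1 p2] p3].
  have z k : vc u k ^+ 2 = 0 -> vc u k = 0 by move/eqP; rewrite sqrf_eq0 => /eqP.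
  have [z1 z2 z3] : [/\ vc u 1 = 0, vc u 2 = 0 & vc u 3 = 0].
    by rewrite /n in n0; split; apply: z; lra.
  have -> : u = vec4 0 0 0 0 by rewrite [LHS]vec4_eta uc0 z1 z2 z3.
  by apply/eqP/matrixP => i j; rewrite !mxE; case: i => [[|[|[|[|//]]]] H].
have uu : u^T *m u = n%:M by rewrite tr_mul_vcE uc0 /n; congr (_%:M); ring.
(* Since [v] and [w] have equal norm, the product of [u] and [w] is minus half the squared norm of
   [u]; the reflection therefore sends [w] to [w + u], which is [v]. *)
have uw : u^T *m w = (- (n / 2))%:M.
  rewrite tr_mul_vcE /w !vc_vec4 uc0 /n uc1 uc2 uc3; congr (_%:M).
  by have := radv_sqr v; lra.
pose A : 'M[R]_4 := 1%:M - (2 / n) *: (u *m u^T).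
have AT : A^T = A by rewrite /A linearB /= trmx1 linearZ /= trmx_mul trmxK.
exists A; first split.
- rewrite AT /A mulmxBl mul1mx mulmxBr mulmx1 -scalemxAl -scalemxAr scalerA.
  rewrite -[u *m u^T *m _]mulmxA [u^T *m (u *m _)]mulmxA uu mul_scalar_mx -scalemxAr scalerA.
  have -> : 2 / n * (2 / n) * n = 2 / n + 2 / n by field.
  by rewrite scalerDl opprB addrK subrK.
- rewrite /A mulmxBl mul1mx -scalemxAl -mulmxA tr_mul_vcE !vc_vec4 uc0.
  by rewrite !mulr0 mul0r !addr0 raddf0 mulmx0 scaler0 subr0.
- rewrite /A mulmxBl mul1mx -scalemxAl -mulmxA uw mul_mx_scalar scalerA.
  have -> : 2 / n * - (n / 2) = -1 by field.
  by rewrite scaleN1r opprK /u addrC subrK.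
Qed.

(** * The inverse of [Phi] and the comparison of induced functions *)

Section Stem.
Variable D : set (R * R).
Hypothesis Dsym : forall a b, D (a, b) -> D (a, - b).

Lemma Dabs a b : D (a, b) -> D (a, `|b|).
Proof. by case: (ger0P b) => // _; exact: Dsym. Qed.

Lemma Eset_axis a b : D (a, b) -> Eset D (vec4 a b 0 0).
Proof. by move=> Dab; rewrite /Eset /= radv_axis !vc_vec4; exact: Dabs. Qed.

(** At [b = 0] the quotient is 0 by the convention for division, which agrees with the vanishing of
    an odd component. *)
Lemma stem_abs F a b : stem D F -> D (a, b) ->
  (F (a, `|b|)).1 = (F (a, b)).1 /\ (b / `|b|) *: (F (a, `|b|)).2 = (F (a, b)).2.
Proof.
move=> sF Dab; have [s1 s2] := sF _ _ Dab.
case: (ltrgt0P b) => [b0|b0|b0].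
- by rewrite divff ?gt_eqF // scale1r.
- by rewrite invrN mulrN divff ?lt_eqF // scaleN1r s2 opprK.
- rewrite b0 mul0r scale0r; split=> //; apply/esym/oct_eqN.
  by move: s2; rewrite b0 oppr0.
Qed.

(** The sign change of the last two coordinates fixes the point, so those components equal their
    opposites; the sign change of [x1] gives the parity of a stem function. *)
Lemma O3stem_axis F a b : O3stem D F -> D (a, b) ->
  [/\ F (vec4 a b 0 0) (oi 2) = 0, F (vec4 a b 0 0) (oi 3) = 0,
      F (vec4 a (- b) 0 0) (oi 0) = F (vec4 a b 0 0) (oi 0) &
      F (vec4 a (- b) 0 0) (oi 1) = - F (vec4 a b 0 0) (oi 1)].
Proof.
move=> sF Dab; have E := Eset_axis Dab.
have N1 : (-1) ^+ 2 = 1 :> R by rewrite sqrrN expr1n.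
have e1 : 1 ^+ 2 = 1 :> R by rewrite expr1n.
have := sF _ _ E (sgmx_O3 e1 N1 N1); rewrite sgmx_vec4 mul1r !mulr0 => H.
have := sF _ _ E (sgmx_O3 N1 e1 e1); rewrite sgmx_vec4 mulN1r !mulr0 => H'.
split; try apply: oct_eqN.
- by rewrite {1}H act4_sgmx /oi inordK //= scaleN1r.
- by rewrite {1}H act4_sgmx /oi inordK //= scaleN1r.
- by rewrite H' act4_sgmx /oi inordK //= scale1r.
- by rewrite H' act4_sgmx /oi inordK //= scaleN1r.
Qed.

Lemma Phi_stem F : O3stem D F -> stem D (Phi F).
Proof. by move=> sF a b Dab; have [_ _] := O3stem_axis sF Dab. Qed.

(** At radius 0 the point is fixed by the sign change of all three coordinates, so the components
    other than the zeroth vanish, in accordance with x / 0 = 0. Otherwise equivariance transports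
    the values from the axis point. *)
Lemma O3stem_formula F v : O3stem D F -> Eset D v ->
  F v (oi 0) = (Phi F (vc v 0, radv v)).1 /\
  forall h, h != oi 0 -> F v h = (vc v h / radv v) *: (Phi F (vc v 0, radv v)).2.
Proof.
move=> sF Ev; rewrite /Phi /=; have [r0|rn0] := eqVneq (radv v) 0.
  have vE : v = vec4 (vc v 0) 0 0 0.
    have z k k4 := @radv_eq0_vcn v k k4 r0.
    by rewrite [LHS]vec4_eta (z 1%N) // (z 2%N) // (z 3%N).
  rewrite r0 -vE; split=> // h h0; rewrite invr0 mulr0 scale0r; apply: oct_eqN.
  have N1 : (-1) ^+ 2 = 1 :> R by rewrite sqrrN expr1n.
  have := sF _ _ Ev (sgmx_O3 N1 N1 N1).
  rewrite {1}vE sgmx_vec4 !mulr0 -vE => /(congr1 (@^~ h)) /= {1}->.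
  rewrite act4_sgmx.
  by case: (ord4_cases h) h0 => ->; rewrite ?eqxx //= /oi inordK //= scaleN1r.
have [A OA vA] := ex_O3_axis v.
have Er : D (vc v 0, radv v) by [].
have Ew := Eset_axis Er.
have := sF _ _ Ew OA; rewrite -vA => ->.
have [z2 z3 _ _] := O3stem_axis sF Er.
have col0 i := O3_col0 i OA.
(* Only columns 0 and 1 of [A] act on the axis values; column 0 is known, and this identity recovers
   column 1 from [v]. *)
have vi (i : 'I_4) : vc v i = (i == oi 0)%:R * vc v 0 + A i (oi 1) * radv v.
  by rewrite -col0 -vec4_mulmx_axis -vA vcE.
split=> [|h h0]; rewrite act4E z2 z3 !scaler0 !addr0 col0.
  rewrite eqxx scale1r; have := vi (oi 0); rewrite eqxx mul1r vc_oi // => e.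
  have /eqP : A (oi 0) (oi 1) * radv v = 0 by lra.
  by rewrite mulf_eq0 (negbTE rn0) orbF => /eqP ->; rewrite scale0r addr0.
by rewrite (negbTE h0) scale0r add0r vi (negbTE h0) mul0r add0r mulfK.
Qed.

(** Division by zero makes the last three components vanish on the real axis, as equivariance
    demands. *)
Definition O3ext (F : R * R -> oct * oct) (v : 'cV[R]_4) (h : 'I_4) : oct :=
  if h == oi 0 then (F (vc v 0, radv v)).1 else (vc v h / radv v) *: (F (vc v 0, radv v)).2.

(** [A] preserves dot products; pairing with the fixed basis vector gives the first coordinate, and
    pairing [v] with itself the radius. *)
Lemma O3_invariants A v : O3 A -> vc (A *m v) 0 = vc v 0 /\ radv (A *m v) = radv v.
Proof.
move=> [AA Ae].
have iso (x y : 'cV[R]_4) : (A *m x)^T *m (A *m y) = x^T *m y.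
  by rewrite trmx_mul -mulmxA [A^T *m (A *m _)]mulmxA AA mul1mx.
have e0 : vc (A *m v) 0 = vc v 0.
  have := iso (vec4 1 0 0 0) v; rewrite Ae !tr_mul_vcE => /(congr1 (fun B : 'M[R]_1 => B ord0 ord0)).
  by rewrite !mxE eqxx !mulr1n !vc_vec4 !mul1r !mul0r !addr0.
split=> //; rewrite /radv; congr Num.sqrt.
have := iso v v; rewrite !tr_mul_vcE => /(congr1 (fun B : 'M[R]_1 => B ord0 ord0)).
by rewrite !mxE eqxx !mulr1n e0; lra.
Qed.

(** The radius is invariant while the coordinates, which enter linearly, are transformed by [A]. *)
Lemma O3ext_stem F : O3stem D (O3ext F).
Proof.
move=> v A Ev OA; have [e0 er] := O3_invariants v OA.
have col0 i := O3_col0 i OA.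
have AvE (i : 'I_4) : vc (A *m v) i =
    A i (oi 0) * vc v 0 + A i (oi 1) * vc v 1 + A i (oi 2) * vc v 2 + A i (oi 3) * vc v 3.
  rewrite vcE mxE !big_ord_recl big_ord0 addr0 !addrA.
  by congr (A i _ * v _ _ + A i _ * v _ _ + A i _ * v _ _ + A i _ * v _ _);
    apply/val_inj; rewrite /= inordK.
apply/funext => i; rewrite act4E /O3ext e0 er eqxx !(negbTE (oi_neq0 _)) // !vc_oi // !scalerA.
rewrite -!addrA -!scalerDl col0.
have -> : A i (oi 1) * (vc v 1 / radv v) + (A i (oi 2) * (vc v 2 / radv v) +
    A i (oi 3) * (vc v 3 / radv v)) = (vc (A *m v) i - A i (oi 0) * vc v 0) / radv v.
  by rewrite AvE; ring.
rewrite col0; case: eqVneq => [->|_].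
  by rewrite vc_oi // e0 mul1r subrr mul0r scale0r addr0 scale1r.
by rewrite scale0r add0r mul0r subr0.
Qed.

Lemma Phi_O3ext F p : stem D F -> D p -> Phi (O3ext F) p = F p.
Proof.
case: p => a b sF Dab; have [s1 s2] := stem_abs sF Dab.
rewrite /Phi /O3ext /= eqxx radv_axis vc_oi // !vc_vec4 s1.
by rewrite (negbTE (oi_neq0 _)) // s2 -surjective_pairing.
Qed.

(** By the explicit formula the last three components are real multiples of one octonion, so
    linearity of the product in its left factor gathers them into the imaginary part of the point,
    [b *: K]; associativity is never invoked. *)
Lemma o3val_Phi F v I J a b K : O3stem D F -> Eset D v -> Nset (I, J) -> D (a, b) -> Sph K ->
  o3pt v I J = a *: oone + b *: K ->
  o3val F v I J = (Phi F (a, b)).1 + omul K (Phi F (a, b)).2.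
Proof.
move=> sF Ev NIJ Dab /SphP[rK nK].
have [Y YE] : exists Y, Y = ocomb (vc v 1) (vc v 2) (vc v 3) I J by eexists.
have [rY nY] := ocomb_frame (vc v 1) (vc v 2) (vc v 3) NIJ.
rewrite -YE -radv_sqr in nY; rewrite -YE in rY.
have -> : o3pt v I J = vc v 0 *: oone + Y by rewrite YE /o3pt /ocomb !addrA.
move=> e.
have e0 : vc v 0 = a.
  by have := congr1 re e; rewrite !reD !reZ rY rK re1 !mulr1 mulr0 !addr0.
have YK : Y = b *: K by move: e; rewrite e0 => /addrI.
have rb : radv v = `|b|.
  by rewrite -sqrtr_sqr -[b ^+ 2]mulr1 -nK expr2 -mulrA -odotZl -odotZr -YK nY sqrtr_sqr
    ger0_norm // radv_ge0.
have [F0 Fh] := O3stem_formula sF Ev.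
have [s1 s2] := stem_abs (Phi_stem sF) Dab.
rewrite /o3val F0 !Fh ?oi_neq0 // !vc_oi // e0 rb s1 -s2 -!addrA; congr (_ + _).
set f := (Phi F _).2; rewrite !omulZr -!omulZl -!omulDl; congr omul.
have -> : (b / `|b|) *: K = `|b|^-1 *: Y by rewrite YK scalerA mulrC.
by rewrite YE /ocomb !scalerDr !scalerA !addrA ?omulZl; congr (_ *: _ + _ *: _ + _ *: _); exact: mulrC.
Qed.

End Stem.

(** [K] is the normalised imaginary part; on the real axis any unit will do, for instance [I]. *)
Lemma o3pt_slice v I J : Nset (I, J) ->
  exists2 K, Sph K & o3pt v I J = vc v 0 *: oone + radv v *: K.
Proof.
move=> NIJ; have [Y YE] : exists Y, Y = ocomb (vc v 1) (vc v 2) (vc v 3) I J by eexists.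
have [rY nY] := ocomb_frame (vc v 1) (vc v 2) (vc v 3) NIJ.
rewrite -YE -radv_sqr in nY; rewrite -YE in rY.
have -> : o3pt v I J = vc v 0 *: oone + Y by rewrite YE /o3pt /ocomb !addrA.
have [r0|rn0] := eqVneq (radv v) 0; last first.
  exists ((radv v)^-1 *: Y); last by rewrite scalerA mulfV // scale1r.
  by apply/SphP; rewrite reZ rY mulr0 odotZl odotZr nY; split=> //; field.
have [SI _] := NIJ; exists I => //; have z k k4 := @radv_eq0_vcn v k k4 r0.
by rewrite YE /ocomb (z 1%N) // (z 2%N) // (z 3%N) // r0 !scale0r !addr0.
Qed.

Lemma ocoordN x m : ocoord (- x) m = - ocoord x m.
Proof. by rewrite /ocoord; case: ifP => _; exact: qcN. Qed.

Lemma ocoordZ a x m : ocoord (a *: x) m = a * ocoord x m.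
Proof. by rewrite /ocoord; case: ifP => _; exact: qcZ. Qed.

Theorem theorem2p1 (D : set (R * R))
  (hDne : D !=set0) (hDopen : open D)
  (hDsym : forall a b, D (a, b) -> D (a, - b))
  (hconn : connected (Omega D)) :
  (* main claim: O(3)-slice functions are exactly the slice functions *)
  (forall f : oct -> oct, o3slice_fun D f <-> slice_fun D f) /\
  (* (1) Phi maps O(3)-stem functions to stem functions ... *)
  (forall F, O3stem D F -> stem D (Phi F)) /\
  (* ... injectively (functions are identified when they agree on E, resp. D) *)
  (forall F G, O3stem D F -> O3stem D G ->
     (forall p, D p -> Phi F p = Phi G p) -> forall v, Eset D v -> F v = G v) /\
  (* ... surjectively onto the stem functions on D *)
  (forall F, stem D F -> exists G, O3stem D G /\ forall p, D p -> Phi G p = F p) /\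
  (* ... and the O(3)-slice function induced by F coincides with the slice
     function induced by Phi F *)
  (forall F, O3stem D F ->
     forall v I J, Eset D v -> Nset (I, J) ->
     forall a b K, D (a, b) -> Sph K -> o3pt v I J = a *: oone + b *: K ->
       o3val F v I J = (Phi F (a, b)).1 + omul K (Phi F (a, b)).2) /\
  (* (2) explicit formula for Phi^{-1} and real analyticity *)
  (forall F G, stem D F -> O3stem D G -> (forall p, D p -> Phi G p = F p) ->
     (forall v, Eset D v -> 0 < radv v ->
        G v (oi 0) = (F (vc v 0, radv v)).1 /\
        forall h : 'I_4, h != oi 0 ->
          G v h = (vc v h / radv v) *: (F (vc v 0, radv v)).2) /\
     (stem_real_analytic D F <-> o3_real_analytic D G)).
Proof.
have inj F G : O3stem D F -> O3stem D G -> (forall p, D p -> Phi F p = Phi G p) ->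
    forall v, Eset D v -> F v = G v.
  move=> sF sG FG v Ev; have [F0 Fh] := O3stem_formula hDsym sF Ev.
  have [G0 Gh] := O3stem_formula hDsym sG Ev; apply/funext => h.
  by have [->|h0] := eqVneq h (oi 0); [rewrite F0 G0 FG | rewrite Fh // Gh // FG].
split; [|split; [|split; [|split; [|split]]]].
- move=> f; split=> [[F [sF fF]]|[F [sF fF]]].
    exists (Phi F); split=> [|a b I Dab SI]; first exact: (Phi_stem hDsym sF).
    have [J NIJ] := ex_orthogonal_unit SI.
    (* Completing [I] to a frame presents [a *: oone + b *: I] as the point with coordinates (a, b,
       0, 0). *)
    have ptE : o3pt (vec4 a b 0 0) I J = a *: oone + b *: I.
      by rewrite /o3pt !vc_vec4 !scale0r !addr0.
    rewrite -ptE fF //; last exact: Eset_axis.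
    exact: (o3val_Phi hDsym sF (Eset_axis hDsym Dab) NIJ Dab SI ptE).
  exists (O3ext F); split=> [|v I J Ev NIJ]; first exact: O3ext_stem.
  have [K SK ptE] := o3pt_slice v NIJ.
  rewrite (o3val_Phi hDsym (@O3ext_stem D F) Ev NIJ Ev SK ptE) ptE fF //.
  by rewrite (Phi_O3ext sF).
- by move=> F; exact: Phi_stem.
- exact: inj.
- move=> F sF; exists (O3ext F); split; first exact: O3ext_stem.
  by move=> p; exact: Phi_O3ext.
- move=> F sF v I J Ev NIJ a b K Dab SK e.
  exact: (o3val_Phi hDsym sF Ev NIJ Dab SK e).
move=> F G sF sG GF.
have GE v : Eset D v -> G v (oi 0) = (F (vc v 0, radv v)).1 /\
    forall h : 'I_4, h != oi 0 -> G v h = (vc v h / radv v) *: (F (vc v 0, radv v)).2.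
  by move=> Ev; rewrite -GF //; exact: (O3stem_formula hDsym sG Ev).
split=> [v Ev _|]; first exact: GE.
split=> [FA h m|GA k m].
  have [->|h0] := eqVneq h (oi 0).
    (* With exponent 0 the coordinate factor is 1, so any nonzero index can be supplied. *)
    apply: (@radial_analytic D (fun p => ocoord (F p).1 m) false (oi 1)) => //.
    + exact: oi_neq0.
    + by move=> a b /sF[-> _]; rewrite expr0 mul1r.
    + exact: (FA true m).
    + by move=> v /GE[-> _]; rewrite expr0 mul1r.
  apply: (@radial_analytic D (fun p => ocoord (F p).2 m) true h) => //.
  + by move=> a b /sF[_ ->]; rewrite ocoordN expr1 mulN1r.
  + exact: (FA false m).
  + by move=> v /GE[_ ->] //; rewrite ocoordZ expr1.
apply: (restriction_analytic (f := fun p => ocoord (if k then (F p).1 else (F p).2) m)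
  hDopen hDsym _ (GA (if k then oi 0 else oi 1) m)) => a b Dab.
by rewrite -GF //; case: k.
Qed.
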